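(* Let $\gamma>0$, let $\Omega\subset\mathbb R^d$ be a bounded domain with smooth boundary, and let $\omega\subset\Omega$ satisfy $\mathcal C^{d-1+\gamma}_{\mathcal H}(\omega)>0$. Let $C_S>0$ be a constant (depending only on $\Omega,\gamma,\omega$) such that for every $\Lambda>0$ and every $v\in L^2(\Omega)$, $$\|\Pi_\Lambda v\|_{L^2(\Omega)}\le C_Se^{C_S\sqrt\Lambda}\sup_{x\in\omega}|\Pi_\Lambda v(x)|.$$ Let $T>0$, let $f\in G^{1,\rho}(\Omega)$ with $\rho>C_S$, and assume $\|f\|_{G^{1,\rho}(\Omega)}\le M$. Suppose that $g\in L^1(0,T)$ and that there exists $c_g>0$ such that $$\left|\int_0^Tg(s)e^{-\lambda_k(T-s)}\,ds\right|\ge\frac{c_g}{\lambda_k},\qquad\forall k\in\mathbb N.$$ Let $u$ be the solution of $$\partial_tu-\Delta u=g(t)f(x)\ \text{ in }\Omega\times(0,T),\qquad u(\cdot,0)=0\ \text{ in }\Omega,\qquad u=0\ \text{ on }\partial\Omega\times(0,T).$$ Then there exist constants $C>0$, depending (for fixed $\Omega$) on $C_S,\rho,c_g,\|g\|_{L^1(0,T)}$, and $\alpha\in(0,1)$, depending on $C_S,\rho$, such that $$\|f\|_{L^2(\Omega)}\le CM^{1-\alpha}\left(\sup_{x\in\omega}|u(x,T)|\right)^\alpha.$$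
   Context: $0<\lambda_1\le\lambda_2\le\cdots\to\infty$ are the eigenvalues of the Dirichlet Laplacian $-\Delta$ on $\Omega$ and $\{\phi_k\}_{k\ge1}$ is a corresponding orthonormal basis of $L^2(\Omega)$ of eigenfunctions. $\Pi_\Lambda$ is the orthogonal projection in $L^2(\Omega)$ onto $\operatorname{span}\{\phi_k:\lambda_k\le\Lambda\}$. The solution is given by Duhamel's formula $u(\cdot,t)=\int_0^tg(s)e^{(t-s)\Delta}f\,ds$. Spectral Gevrey class: for $\rho>0$ and $f_k=\langle f,\phi_k\rangle_{L^2(\Omega)}$, $$G^{1,\rho}(\Omega)=\Big\{f\in L^2(\Omega):\sum_{k\ge1}e^{2\rho\sqrt{\lambda_k}}|f_k|^2<\infty\Big\},\qquad \|f\|_{G^{1,\rho}(\Omega)}=\Big(\sum_{k\ge1}e^{2\rho\sqrt{\lambda_k}}|f_k|^2\Big)^{1/2}.$$ Hausdorff content: for $E\subset\mathbb R^d$ and $s\ge0$, $\mathcal C^s_{\mathcal H}(E)=\inf\{\sum_{j=1}^\infty r_j^s: E\subset\bigcup_{j}B(x_j,r_j)\}$. (The existence of a constant $C_S$ as in the claim is a known result for such $\omega$.) *)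

(* Defs.v *)
From HB Require Import structures.
From mathcomp Require Import all_boot all_order all_algebra.
From mathcomp Require Import all_classical all_reals all_analysis.

Set Implicit Arguments.
Unset Strict Implicit.
Unset Printing Implicit Defensive.
Import Order.TTheory GRing.Theory Num.Theory.
Import numFieldNormedType.Exports.
Local Open Scope classical_set_scope.
Local Open Scope ring_scope.

Definition rV_display : measure_display. Proof. exact: default_measure_display. Qed.

(* The sigma-algebra on 'rV[R]_d generated by the coordinate maps, i.e. the
   d-fold product of the Borel sigma-algebra of R (the Borel sigma-algebra of
   the canonical topology of 'rV[R]_d). *)
Section rV_measurable.
Context {R : realType} (d : nat).

Let coord : 'I_d -> 'rV[R]_d -> R := fun i x => x ord0 i.

Let rV_set0 : g_sigma_preimage coord set0.
Proof. exact: sigma_algebra0. Qed.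

Let rV_setC A : g_sigma_preimage coord A -> g_sigma_preimage coord (~` A).
Proof. exact: sigma_algebraC. Qed.

Let rV_bigcup (F : _^nat) : (forall i, g_sigma_preimage coord (F i)) ->
  g_sigma_preimage coord (\bigcup_i (F i)).
Proof. exact: sigma_algebra_bigcup. Qed.

HB.instance Definition _ := @isMeasurable.Build rV_display
  'rV[R]_d (g_sigma_preimage coord) rV_set0 rV_setC rV_bigcup.

End rV_measurable.

Lemma measurable_coord (R : realType) d (i : 'I_d) :
  measurable_fun [set: 'rV[R]_d] (fun x => x ord0 i).
Proof.
move=> _ Y mY; rewrite setTI; apply: sub_sigma_algebra => /=.
rewrite -bigcup_seq/=; exists i => /=; first by rewrite mem_index_enum.
by exists Y => //; rewrite setTI.
Qed.

Lemma measurable_fun_rV (R : realType) d d1 (T : measurableType d1)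
    (f : T -> 'rV[R]_d) :
  (forall i, measurable_fun [set: T] (fun x => f x ord0 i)) ->
  measurable_fun [set: T] f.
Proof.
move=> mf; suff : preimage_set_system [set: T] f measurable `<=` measurable.
  by move=> H _ A mA; apply: H; exists A.
rewrite -[X in X `<=` _]g_sigma_preimage_comp.
apply: smallest_sub; first exact: sigma_algebra_measurable.
rewrite -bigcup_seq; apply: bigcup_sub => i _ A [B mB <-].
exact: mf.
Qed.

Definition rV_cons {R : realType} {d} (p : measurableTypeR R * 'rV[R]_d) : 'rV[R]_d.+1 :=
  row_mx (const_mx p.1 : 'rV_1) p.2.

Definition rV_uncons {R : realType} {d} (x : 'rV[R]_d.+1) : measurableTypeR R * 'rV[R]_d :=
  (x ord0 ord0, @rsubmx R 1 1 d x).

Lemma rV_consK {R : realType} {d} : cancel (@rV_cons R d) rV_uncons.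
Proof.
case=> a v; rewrite /rV_uncons /rV_cons row_mxKr /=; congr pair.
have -> : ord0 = lshift d (ord0 : 'I_1) by apply/val_inj.
by rewrite (@row_mxEl _ _ 1 d) mxE.
Qed.

Lemma measurable_rV_cons {R : realType} {d} :
  measurable_fun setT (@rV_cons R d).
Proof.
apply: measurable_fun_rV => i; case: (@splitP 1 d i) => j ij.
- have -> : i = lshift d j by apply/val_inj.
  rewrite /rV_cons; under eq_fun do rewrite (@row_mxEl _ _ 1 d) mxE.
  exact: measurable_fst.
- have -> : i = rshift 1 j by apply/val_inj.
  rewrite /rV_cons; under eq_fun do rewrite (@row_mxEr _ _ 1 d).
  exact: measurableT_comp (measurable_coord j) measurable_snd.
Qed.

Lemma measurable_rV_uncons {R : realType} {d} :
  measurable_fun setT (@rV_uncons R d).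
Proof.
apply: measurable_fun_pair; first exact: measurable_coord.
apply: measurable_fun_rV => i.
by under eq_fun do rewrite mxE; exact: measurable_coord.
Qed.

Lemma sigma_finite_product_measure d1 d2 (T1 : measurableType d1)
    (T2 : measurableType d2) (R : realType)
    (m1 : {sigma_finite_measure set T1 -> \bar R})
    (m2 : {sigma_finite_measure set T2 -> \bar R}) :
  sigma_finite setT (m1 \x m2)%E.
Proof.
have /sigma_finiteP[F [TF ndF Foo]] := sigma_finiteT m1.
have /sigma_finiteP[G [TG ndG Goo]] := sigma_finiteT m2.
exists (fun n => F n `*` G n).
  rewrite -setXTT TF TG predeqE => -[x y]; split.
    move=> [/= [n _ Fnx] [k _ Gky]]; exists (maxn n k) => //; split.
    - by move: x Fnx; exact/subsetPset/ndF/leq_maxl.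
    - by move: y Gky; exact/subsetPset/ndG/leq_maxr.
  by move=> [n _ []/= ? ?]; split; exists n.
move=> k; have [? ?] := Foo k; have [? ?] := Goo k.
split; first exact: measurableX.
by rewrite product_measure1E// lte_mul_pinfty// ge0_fin_numE.
Qed.

Section lebesgue_rV_step.
Context {R : realType} {d : nat}.
Variable m : {sigma_finite_measure set 'rV[R]_d -> \bar R}.

Definition lebesgue_rV_step : set 'rV[R]_d.+1 -> \bar R :=
  pushforward (@lebesgue_measure R \x m)%E rV_cons.

Let step0 : lebesgue_rV_step set0 = 0%E.
Proof. by rewrite /lebesgue_rV_step /pushforward preimage_set0 measure0. Qed.

Let step_ge0 A : (0 <= lebesgue_rV_step A)%E.
Proof. by rewrite /lebesgue_rV_step /pushforward measure_ge0. Qed.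

Let step_sigma_additive : semi_sigma_additive lebesgue_rV_step.
Proof.
have mc := @measurable_rV_cons R d.
move=> F mF tF mUF; rewrite /lebesgue_rV_step /pushforward preimage_bigcup.
apply: measure_semi_sigma_additive.
- by move=> n; rewrite -[X in measurable X]setTI; exact: mc.
- apply/trivIsetP => /= i j _ _ ij; rewrite -preimage_setI.
  by move/trivIsetP : tF => /(_ _ _ _ _ ij) ->//; rewrite preimage_set0.
- by rewrite -preimage_bigcup -[X in measurable X]setTI; exact: mc.
Qed.

HB.instance Definition _ := isMeasure.Build _ _ _ lebesgue_rV_step
  step0 step_ge0 step_sigma_additive.

Let step_sigma_finite : sigma_finite setT lebesgue_rV_step.
Proof.
have [F FT mF] := sigma_finite_product_measure (@lebesgue_measure R) m.
exists (fun n => rV_uncons @^-1` F n).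
  by rewrite -preimage_bigcup -FT preimage_setT.
move=> n; have [mFn Fnoo] := mF n; split.
  by rewrite -[X in measurable X]setTI; exact: measurable_rV_uncons.
rewrite /lebesgue_rV_step /pushforward.
rewrite (_ : _ @^-1` _ = F n)//.
by apply/seteqP; split=> p /=; rewrite rV_consK.
Qed.

HB.instance Definition _ := Measure_isSigmaFinite.Build _ _ _ lebesgue_rV_step
  step_sigma_finite.

End lebesgue_rV_step.

(* Lebesgue measure on R^d, as the iterated product of d copies of the
   one-dimensional Lebesgue measure. *)
Fixpoint lebesgue_rV {R : realType} (d : nat) :
    {sigma_finite_measure set 'rV[R]_d -> \bar R} :=
  match d with
  | 0 => dirac (0 : 'rV[R]_0)
  | d'.+1 => lebesgue_rV_step (lebesgue_rV d')
  end.

Section domains.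
Context {R : realType} {d : nat}.
Implicit Types (A U Omega : set 'rV[R]_d) (f : 'rV[R]_d -> R).

(* The norm `|x| of 'rV[R]_d in the library is the sup norm. *)
Definition euclidean_norm (x : 'rV[R]_d) : R :=
  Num.sqrt (\sum_(i < d) x ord0 i ^+ 2).

Definition partial (i : 'I_d) f : 'rV[R]_d -> R :=
  fun x => 'D_(delta_mx ord0 i) f x.

Definition partials (s : seq 'I_d) f : 'rV[R]_d -> R := foldr partial f s.

(* f is of class C^k on the open set U: all partial derivatives of order at
   most k exist and are continuous at the points of U. *)
Definition Ck_on (k : nat) U f : Prop :=
  forall (s : seq 'I_d) x, U x ->
    ((size s <= k)%N -> {for x, continuous (partials s f)}) /\
    ((size s < k)%N ->
       forall i, derivable (partials s f) x (delta_mx ord0 i)).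

Definition smooth_on U f : Prop := forall k, Ck_on k U f.

Definition laplacian f : 'rV[R]_d -> R :=
  fun x => \sum_(i < d) partial i (partial i f) x.

Definition boundary A : set 'rV[R]_d := closure A `\` interior A.

(* Near each boundary point, Omega is the sublevel set {psi < 0} of a smooth
   function with nonvanishing gradient at that point; by the implicit function
   theorem, Omega is locally the region on one side of a smooth graph. *)
Definition smooth_boundary Omega : Prop :=
  forall p, boundary Omega p ->
    exists (U : set 'rV[R]_d) (psi : 'rV[R]_d -> R),
      [/\ open U, U p, smooth_on U psi,
          exists i, partial i psi p != 0 &
          Omega `&` U = U `&` [set x | psi x < 0]].

Record smooth_bounded_domain Omega : Prop := {
  sbd_open : open Omega ;
  sbd_connected : connected Omega ;
  sbd_nonempty : Omega !=set0 ;
  sbd_bounded : bounded_set Omega ;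
  sbd_boundary : smooth_boundary Omega }.

(* s-dimensional Hausdorff content. A ball of radius 0 is empty, so that for
   s > 0 the covers range over the finite and the countable ones. *)
Definition hausdorff_content (s : R) (E : set 'rV[R]_d) : \bar R :=
  ereal_inf [set (\sum_(0 <= j <oo) (powR (c.2 j) s)%:E)%E |
    c in [set c : (nat -> 'rV[R]_d) * (nat -> R) |
      (forall j, 0 <= c.2 j) /\
      E `<=` \bigcup_j [set y | euclidean_norm (y - c.1 j) < c.2 j]]].

Definition sup_abs (E : set 'rV[R]_d) f : \bar R :=
  ereal_sup [set (`|f x|)%:E | x in E].

End domains.

Section spectral.
Context {R : realType} {d : nat}.
Variable Omega : set 'rV[R]_d.
Implicit Types (v w f phi : 'rV[R]_d -> R).

(* Elements of L^2(Omega) are represented by functions on R^d, of which only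
   the restriction to Omega matters. *)
Definition L2 v : Prop := (v \_ Omega) \in Lfun (lebesgue_rV d) 2%:E.

Definition L2norm v : R := fine ('N[lebesgue_rV d]_2%:E[EFin \o (v \_ Omega)]).

Definition L2inner v w : R :=
  (\int[lebesgue_rV d]_(x in Omega) (v x * w x))%R.

(* Classical solutions, in C^2(Omega) and C(closure Omega), of the Dirichlet
   eigenvalue problem; on a bounded smooth domain these are the eigenfunctions
   of the Dirichlet Laplacian, by elliptic regularity. *)
Definition dirichlet_eigenfunction (mu : R) phi : Prop :=
  [/\ Ck_on 2 Omega phi,
      {within closure Omega, continuous phi},
      (forall x, Omega x -> - laplacian phi x = mu * phi x) &
      (forall x, boundary Omega x -> phi x = 0)].

(* lam enumerates the Dirichlet eigenvalues in nondecreasing order, with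
   multiplicity: since phi is a Hilbert basis, no eigenvalue is missed. The
   indexing starts at 0. *)
Record dirichlet_eigenbasis (lam : nat -> R) (phi : nat -> 'rV[R]_d -> R) :
    Prop := {
  deb_pos : forall k, 0 < lam k ;
  deb_nondecreasing : nondecreasing_seq lam ;
  deb_cvg : lam @ \oo --> +oo ;
  deb_eigen : forall k, dirichlet_eigenfunction (lam k) (phi k) ;
  deb_L2 : forall k, L2 (phi k) ;
  deb_orthonormal : forall j k, L2inner (phi j) (phi k) = (j == k)%:R ;
  deb_complete : forall v, L2 v ->
    (fun n => L2norm (fun x => v x - \sum_(k < n) L2inner v (phi k) * phi k x))
      @ \oo --> (0 : R) }.

Variables (lam : nat -> R) (phi : nat -> 'rV[R]_d -> R).

(* Orthogonal projection onto the span of the phi k with lam k <= Lambda, a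
   finite set of indices since lam tends to infinity. It is given by its
   continuous representative, which has values at every point. *)
Definition spectral_proj (Lambda : R) v : 'rV[R]_d -> R :=
  fun x => \sum_(k \in [set k | lam k <= Lambda]) L2inner v (phi k) * phi k x.

Definition gevrey_energy (rho : R) f : \bar R :=
  (\sum_(0 <= k <oo)
    (expR (2 * rho * Num.sqrt (lam k)) * `|L2inner f (phi k)| ^+ 2)%:E)%E.

Definition gevrey (rho : R) f : Prop := L2 f /\ (gevrey_energy rho f < +oo)%E.

Definition gevrey_norm (rho : R) f : R := Num.sqrt (fine (gevrey_energy rho f)).

(* e^{t Delta} f, as the pointwise sum of its spectral series. *)
Definition heat_semigroup (t : R) f : 'rV[R]_d -> R :=
  fun x => limn (fun n =>
    \sum_(k < n) expR (- lam k * t) * L2inner f (phi k) * phi k x).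

(* Duhamel's formula for the solution of
   u_t - Delta u = g(t) f(x), u(., 0) = 0, u = 0 on the boundary. *)
Definition duhamel (g : R -> R) f (t : R) : 'rV[R]_d -> R :=
  fun x => (\int[lebesgue_measure]_(s in `]0, t[)
              (g s * heat_semigroup (t - s) f x))%R.

End spectral.

(* Main.v *)
Require Import Defs.
From HB Require Import structures.
From mathcomp Require Import all_boot all_order all_algebra.
From mathcomp Require Import all_classical all_reals all_analysis.
From mathcomp Require Import measurable_realfun.
From mathcomp Require Import ring lra.
Import Order.TTheory GRing.Theory Num.Theory.
Import numFieldNormedType.Exports.
Local Open Scope classical_set_scope.
Local Open Scope ring_scope.

(** Write f_k = <f, phi_k> and a_k = int_0^T g(s) exp(-lam_k (T-s)) ds. At a
    point x of Omega, u(x,T) = sum_k a_k f_k phi_k(x). Hence the part of u(.,T)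
    with lam_k <= Lambda is the spectral projection of an explicit finite
    combination of eigenfunctions, and the spectral inequality bounds its L^2
    norm by its supremum over omega. That supremum is at most
    sup_omega |u(.,T)| plus the sup norm of the tail lam_k > Lambda. The lower
    bound |a_k| >= c_g / lam_k then gives back the low modes of f at the cost
    of a factor Lambda / c_g, while the Gevrey bound makes the high modes
    of f, and the tail of u, exponentially small in sqrt Lambda. Since
    rho > C_S, the decay of the tail beats the growth exp(C_S sqrt Lambda),
    so that for r = sqrt Lambda
      ||f|| <= C0 (exp(p r) sup_omega |u| + M exp(-q r)),   p, q > 0
    (cutoff_estimate), and optimizing over r yields the Hoelder exponent
    q / (p + q) (interpolation_optimization).

    The tail of u is estimated pointwise, which needs a bound on
    sum_k exp(-2 eps sqrt lam_k) phi_k(x)^2 uniform in x and depending on the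
    eigenbasis only through a box containing Omega (bergman_bound). It comes
    from the smoothing of the heat semigroup from L^2 to sup norm
    (heat_smoothing), obtained by the maximum principle: a heat solution
    U = sum_k c_k exp(-lam_k s) phi_k, zero on the boundary, is dominated by a
    finite sum of Gaussians, one for each cell of a grid, whose weights
    dominate U at time 0. A Gaussian of width comparable to the cell, with a
    weight multiplied by a dimensional constant, already dominates its weight
    on the cell. At time t the majorant is at most a constant times t^(-d/2)
    times a Riemann sum of |U(.,0)|, which the L^2 norm controls. By duality
    this bounds the diagonal sum_k exp(-2 lam_k t) phi_k(x)^2 of the heat kernel,
    and summing over t = m^-2 with weights exp(-2 eps m) replaces lam_k by
    sqrt lam_k. *)

(** * Calculus on lines and the parabolic maximum principle *)

(** The second derivative only ever occurs along coordinate lines, at their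
    base point, so that one real variable suffices to state the maximum
    principle. *)
Definition deriv2_at0 {R : realType} (f : R -> R) (l : R) : Prop :=
  exists2 f' : R -> R, nbhs (0 : R) (fun h : R => is_derive h 1 f (f' h))
                     & is_derive (0 : R) 1 f' l.

Lemma is_derive_quotient (R : realType) (f : R -> R) (x l : R) :
  is_derive x 1 f l -> (fun h => h^-1 * (f (h + x) - f x)) @ 0^' --> l.
Proof.
move=> [df <-]; have := df; rewrite /derivable /derive /=.
by under eq_fun do rewrite /GRing.scale /= mulr1.
Qed.

Lemma is_derive_left_max (R : realType) (f : R -> R) (a x l : R) :
  a < x -> is_derive x 1 f l -> (forall y, a <= y <= x -> f y <= f x) -> 0 <= l.
Proof.
move=> ax /is_derive_quotient fl fx; rewrite leNgt; apply/negP => l0.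
have /nbhs_normP[e /= e0 He] : nbhs (0 : R)
    (fun h : R => h != 0 -> h^-1 * (f (h + x) - f x) < 0).
  exact: (cvgr_lt l fl 0 l0).
pose h := - (Num.min (e / 2) (x - a)).
have h0 : h < 0 by rewrite oppr_lt0 lt_min; apply/andP; split; lra.
have he : `|h| < e.
  rewrite ltr0_norm// opprK; apply: (@le_lt_trans _ _ (e / 2)); last lra.
  by rewrite ge_min lexx.
have hx : a - x <= h by rewrite lerNr opprB ge_min lexx orbT.
have := He h; rewrite /= sub0r normrN he => /(_ isT).
rewrite lt_eqF// => /(_ isT); apply/negP; rewrite -leNgt.
by rewrite mulr_le0// ?invr_le0 ?(ltW h0)// subr_le0 fx//; apply/andP; split; lra.
Qed.

Lemma deriv2_local_max (R : realType) (f : R -> R) (l : R) :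
  deriv2_at0 f l -> (\forall h \near (0 : R), f h <= f 0) -> l <= 0.
Proof.
move=> [f' f'f f'l] fmax; rewrite leNgt; apply/negP => l0.
have /nbhs_normP[e /= e0 He] : nbhs (0 : R)
    (fun h : R => is_derive h 1 f (f' h) /\ f h <= f 0).
  by apply: filterI.
have {}He h : - e < h < e -> is_derive h 1 f (f' h) /\ f h <= f 0.
  by move=> he; apply: He; rewrite /= sub0r normrN ltr_norml.
have f'0 : f' 0 = 0.
  have N0e : - e < 0 < e by rewrite oppr_lt0 e0.
  have e_itv t : t \in `](- e), e[ -> - e < t < e by rewrite in_itv.
  have Nee : - e <= e by lra.
  have d0 : is_derive (0 : R) 1 f 0.
    apply: (derive1_at_max Nee); first by move=> t /e_itv/He[[]].
      by rewrite in_itv.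
    by move=> t /e_itv/He[].
  have [d0' _] := He 0 N0e.
  by rewrite -(@derive_val _ _ _ _ _ _ _ d0') (@derive_val _ _ _ _ _ _ _ d0).
have /nbhs_normP[e' /= e'0 He'] : nbhs (0 : R)
    (fun h : R => h != 0 -> 0 < h^-1 * (f' (h + 0) - f' 0)).
  exact: (cvgr_gt l (is_derive_quotient _ _ _ _ f'l) 0 l0).
pose b := Num.min e e' / 2.
have b0 : 0 < b by rewrite divr_gt0// lt_min e0.
have be : b < e by rewrite ltr_pdivrMr// gt_min; apply/orP; left; lra.
have be' : b < e' by rewrite ltr_pdivrMr// gt_min; apply/orP; right; lra.
have [c c0b fb] : exists2 c, c \in `]0, b[%R & f b - f 0 = f' c * (b - 0).
  apply: MVT => //.
  - by move=> x; rewrite in_itv/= => x0b; by have [|? _ //] := He x; lra.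
  - apply: continuous_in_subspaceT => x; rewrite inE/= in_itv/= => x0b.
    have [|[dx _] _] := He x; first lra.
    exact/differentiable_continuous/derivable1_diffP.
move: c0b; rewrite in_itv/= => /andP[c0 cb].
have := He' c; rewrite /= sub0r normrN gtr0_norm// (lt_trans cb be')//.
move=> /(_ isT); rewrite gt_eqF// => /(_ isT); rewrite addr0 f'0 subr0 => f'c.
have f'c0 : 0 < f' c by rewrite -(pmulr_rgt0 _ (_ : 0 < c^-1)) ?invr_gt0.
have [|_] := He b; first lra.
by rewrite -subr_le0 fb subr0 leNgt mulr_gt0.
Qed.

(** D is defined on the whole space and nonpositive outside Omega, so that the
    maximum of D - eps s may be sought on a compact box times [0, t]. If it is
    positive, it is reached in Omega at a positive time, and moving out of the
    box along a coordinate line cannot exceed it. There the time derivative of D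
    is at least eps while the sum of its second derivatives is at most 0. *)
Lemma parabolic_max_principle (R : realType) (d : nat) (Omega : set 'rV[R]_d)
    (L : R) (D : 'rV[R]_d -> R -> R) (t : R) :
  (forall y i, Omega y -> `|y ord0 i| <= L) ->
  (forall y s, 0 <= s <= t -> {for (y, s), continuous (fun p => D p.1 p.2)}) ->
  (forall y s, ~ Omega y -> 0 <= s <= t -> D y s <= 0) ->
  (forall y, D y 0 <= 0) ->
  (forall y s, Omega y -> 0 < s <= t ->
     exists (Ds : R) (D2 : 'I_d -> R),
       [/\ is_derive s 1 (D y) Ds,
           forall i, deriv2_at0 (fun h : R => D (y + h *: delta_mx ord0 i) s) (D2 i) &
           Ds <= \sum_i D2 i]) ->
  forall y s, 0 <= s <= t -> D y s <= 0.
Proof.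
move=> bO cD Dout D0 Deq y0 s0 s0t; rewrite leNgt; apply/negP => Dpos.
have [Oy0|/Dout/(_ s0t)] := pselect (Omega y0); last by rewrite leNgt Dpos.
have t0 : 0 <= t by case/andP: s0t => /le_trans; apply.
(* small enough for D - eps s to stay positive at (y0, s0) *)
pose eps := D y0 s0 / (2 * (t + 1)).
have eps0 : 0 < eps by rewrite divr_gt0//; lra.
pose F (p : 'rV[R]_d * R) := D p.1 p.2 - eps * p.2.
have F0 : 0 < F (y0, s0).
  rewrite /F /= subr_gt0; apply: (@le_lt_trans _ _ (eps * t)).
    by rewrite ler_pM2l//; case/andP: s0t.
  rewrite /eps mulrAC ltr_pdivrMr ?mulr_gt0//; [nra|lra].
pose box := [set v : 'rV[R]_d | forall i, `[- L, L]%classic (v ord0 i)].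
have Obox y : Omega y -> box y.
  by move=> Oy i; rewrite /= in_itv/= -ler_norml bO.
have cF : {within box `*` `[0, t]%classic, continuous F}.
  apply: continuous_in_subspaceT => -[y s]; rewrite inE => -[/= _].
  rewrite in_itv/= => st; apply: cvgB; first exact: cD.
  apply: cvgMr; exact: cvg_snd.
have cO : compact (box `*` `[0, t]%classic).
  apply: compact_setX; last exact: segment_compact.
  by apply: (@rV_compact _ _ (fun=> `[- L, L]%classic)) => _; exact: segment_compact.
have [|[y s] /[!inE] [[/= Oy st]] Fmax] := compact_EVT_max _ cO cF.
  by exists (y0, s0); split => /=; [exact: Obox|rewrite in_itv].
rewrite in_itv/= in st.
have Fys : 0 < F (y, s).
  apply: lt_le_trans F0 _; apply: Fmax; rewrite inE; split => /=.
    exact: Obox.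
  by rewrite in_itv.
have Dys : 0 < D y s.
  by move: Fys; rewrite /F/= subr_gt0; apply: le_lt_trans; rewrite mulr_ge0 ?(ltW eps0)//;
    case/andP: st.
have Oys : Omega y.
  by apply: contrapT => /Dout/(_ st); rewrite leNgt Dys.
have s_gt0 : 0 < s.
  case/andP: st; rewrite le_eqVlt => /predU1P[s0'|//] _.
  by move: Dys; rewrite -s0' ltNge D0.
have [|Ds [D2 [dDs dD2 DsD2]]] := Deq y s Oys.
  by rewrite s_gt0; case/andP: st.
have Ds_ge : 0 <= Ds - eps.
  apply: (@is_derive_left_max _ (fun s => D y s - eps * s) 0 s) => //.
    have deps : is_derive s 1 (fun s : R => eps * s) eps.
      have h := @is_deriveZ R R^o R^o id eps s 1 1 (is_derive_id _ _).
      by apply: is_derive_eq h _; rewrite /GRing.scale/= mulr1.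
    exact: is_deriveB.
  move=> s' /andP[s'0 s's]; apply: (Fmax (y, s')); rewrite inE; split => //=.
  by rewrite in_itv/= s'0 (le_trans s's)//; case/andP: st.
have D2_le i : D2 i <= 0.
  apply: deriv2_local_max (dD2 i) _; near=> h; rewrite scale0r addr0.
  set y' := y + _.
  have [Oy'|nOy'] := pselect (Omega y').
    have := Fmax (y', s); rewrite /F/= lerD2r; apply; rewrite inE; split => /=.
      exact: Obox.
    by rewrite in_itv.
  exact: le_trans (Dout _ _ nOy' st) (ltW Dys).
have : \sum_i D2 i <= 0 by apply: sumr_le0.
lra.
Unshelve. all: by end_near. Qed.

(** * Dirichlet eigenfunctions extended by zero *)

Lemma deriv2_at0D (R : realType) (f g : R -> R) (a b : R) :
  deriv2_at0 f a -> deriv2_at0 g b -> deriv2_at0 (fun h => f h + g h) (a + b).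
Proof.
move=> [f' f'f f'a] [g' g'g g'b]; exists (fun h => f' h + g' h).
  by apply: filterS2 f'f g'g => h; exact: is_deriveD.
exact: is_deriveD.
Qed.

Lemma is_derive_mull (R : realType) (c : R) (f : R -> R) (x a : R) :
  is_derive x 1 f a -> is_derive x 1 (fun h => c * f h) (c * a).
Proof. by move=> fa; exact: (@is_deriveZ _ _ _ f c). Qed.

Lemma deriv2_at0Z (R : realType) (c : R) (f : R -> R) (a : R) :
  deriv2_at0 f a -> deriv2_at0 (fun h => c * f h) (c * a).
Proof.
move=> [f' f'f f'a]; exists (fun h => c * f' h); last exact: is_derive_mull.
by apply: filterS f'f => h; exact: is_derive_mull.
Qed.

Lemma is_derive_bigsum (R : realType) (I : Type) (r : seq I) (f : I -> R -> R)
    (x : R) (a : I -> R) :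
  (forall i, is_derive x 1 (f i) (a i)) ->
  is_derive x 1 (fun h => \sum_(i <- r) f i h) (\sum_(i <- r) a i).
Proof.
move=> fa; elim: r => [|i r ih].
  by under eq_fun do rewrite big_nil; rewrite big_nil; exact: is_derive_cst.
by under eq_fun do rewrite big_cons; rewrite big_cons; exact: is_deriveD.
Qed.

Lemma deriv2_at0_bigsum (R : realType) (I : Type) (r : seq I) (f : I -> R -> R)
    (a : I -> R) :
  (forall i, deriv2_at0 (f i) (a i)) ->
  deriv2_at0 (fun h => \sum_(i <- r) f i h) (\sum_(i <- r) a i).
Proof.
move=> fa; elim: r => [|i r ih].
  under eq_fun do rewrite big_nil; rewrite big_nil; exists (cst 0).
    by near=> h; exact: is_derive_cst.
  exact: is_derive_cst.
have -> : (fun h => \sum_(i <- i :: r) f i h) =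
          (fun h => f i h + \sum_(i <- r) f i h).
  by apply/funext => h; rewrite big_cons.
by rewrite big_cons; exact: deriv2_at0D.
Unshelve. all: by end_near. Qed.

Lemma is_derive_line (R : realType) (d : nat) (f : 'rV[R]_d -> R)
    (y v : 'rV[R]_d) (h : R) :
  derivable f (y + h *: v) v ->
  is_derive h 1 (fun h : R => f (y + h *: v)) ('D_v f (y + h *: v)).
Proof.
have E : (fun k : R => k^-1 *: (((fun h : R => f (y + h *: v)) \o shift h)
             (k *: (1 : R)) - f (y + h *: v))) =
         (fun k : R => k^-1 *: ((f \o shift (y + h *: v)) (k *: v) - f (y + h *: v))).
  apply/funext => k /=; congr (_ *: (f _ - _)).
  have -> : k *: (1 : R) = k by exact: mulr1.
  by rewrite scalerDl addrCA.
by move=> df; apply: DeriveDef; rewrite /derivable /derive E.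
Qed.

Lemma near_line (R : realType) (d : nat) (U : set 'rV[R]_d) (y v : 'rV[R]_d) (h : R) :
  open U -> U (y + h *: v) -> \forall k \near h, U (y + k *: v).
Proof.
move=> oU Uy.
have c : {for h, continuous (fun k : R => y + k *: v)}.
  apply: cvgD; first exact: cvg_cst.
  by apply: cvgZr_tmp; exact: cvg_id.
by apply: c; exact: open_nbhs_nbhs.
Qed.

Lemma deriv2_at0_partial (R : realType) (d : nat) (Omega : set 'rV[R]_d)
    (f : 'rV[R]_d -> R) (y : 'rV[R]_d) (i : 'I_d) :
  open Omega -> Ck_on 2 Omega f -> Omega y ->
  deriv2_at0 (fun h : R => (f \_ Omega) (y + h *: delta_mx ord0 i))
             (partial i (partial i f) y).
Proof.
move=> oO fC Oy; set v := delta_mx ord0 i.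
have Oy0 : Omega (y + 0 *: v) by rewrite scale0r addr0.
exists (fun h => partial i f (y + h *: v)).
  have near0 := near_line _ _ _ _ _ _ oO Oy0.
  near=> h.
  have Oh : Omega (y + h *: v) by near: h.
  have df : derivable f (y + h *: v) v by have [_] := fC [::] _ Oh; exact.
  have := is_derive_line _ _ _ _ _ _ df.
  apply: near_eq_is_derive.
  near=> k; rewrite patchE mem_set//.
  by near: k; exact: near_line.
have df : derivable (partial i f) (y + 0 *: v) v.
  by have [_] := fC [:: i] _ Oy0; exact.
have := is_derive_line _ _ _ _ _ _ df.
by rewrite [in X in _ -> X]/partial -/(partial i f) scale0r addr0.
Unshelve. all: by end_near. Qed.

(** Extending by zero turns the boundary condition into continuity on the whole
    space, which spares all later arguments a treatment of the closure. *)
Lemma continuous_zero_extension (R : realType) (d : nat) (Omega : set 'rV[R]_d)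
    (f : 'rV[R]_d -> R) :
  open Omega -> Ck_on 0 Omega f -> {within closure Omega, continuous f} ->
  (forall x, boundary Omega x -> f x = 0) -> continuous (f \_ Omega).
Proof.
move=> oO fC fc f0 x.
have [Ox|nOx] := pselect (Omega x).
  have [cf _] := fC [::] x Ox.
  have E : {near x, f =1 f \_ Omega}.
    have : nbhs x Omega by exact: open_nbhs_nbhs.
    by apply: filterS => y Oy; rewrite patchE mem_set.
  rewrite /continuous_at patchE mem_set//.
  exact: cvg_trans (near_eq_cvg E) (cf isT).
rewrite /continuous_at patchE memNset//.
have [cx|ncx] := pselect (closure Omega x); last first.
  suff : nbhs x [set y | (f \_ Omega) y = 0].
    by move=> h; apply: cvg_near_cst h.
  have : nbhs x (~` closure Omega).
    by apply: open_nbhs_nbhs; split => //; exact/closed_openC/closed_closure.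
  apply: filterS => y ncy; rewrite /mkset patchE memNset// => Oy; apply: ncy.
  exact: subset_closure.
have fx : f x = 0 by apply: f0; split => // /interior_subset.
have fcx : f @ within (closure Omega) (nbhs x) --> (0 : R).
  by rewrite -fx; move/subspace_continuousP : fc => /(_ x cx).
have Fx := nbhs_filter x.
apply/cvgr0Pnorm_lt => e e0.
have H : nbhs x (fun y => closure Omega y -> `|f y| < e).
  by move/cvgr0Pnorm_lt : fcx => /(_ e e0).
apply: filterS H => y H'; rewrite /mkset patchE; case: ifPn => [|_].
  by rewrite inE => Oy; apply: H'; exact: subset_closure.
by rewrite normr0.
Qed.

(** * Gaussian solutions of the heat equation *)

Definition sqdist {R : realType} {d : nat} (z y : 'rV[R]_d) : R :=
  \sum_(i < d) (y ord0 i - z ord0 i) ^+ 2.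

(** The heat kernel centred at z, at time sigma, up to the factor (4 pi)^(d/2).
    The power sigma^(-d/2) is kept inside the exponential, so that one chain
    rule differentiates everything. *)
Definition gauss_kernel {R : realType} {d : nat} (z y : 'rV[R]_d) (sigma : R) : R :=
  expR (- (d%:R / 2) * ln sigma - sqdist z y / 4 * sigma^-1).

Lemma is_derive_inv1 (R : realType) (x : R) :
  x != 0 -> is_derive x 1 (fun y : R => y^-1) (- x ^- 2).
Proof.
move=> x0; have dx : derivable (fun y : R => y) x 1 by exact: derivable_id.
apply: DeriveDef; first exact: (@derivableV _ _ (fun y : R => y) x 1 x0).
rewrite (@deriveV _ _ (fun y : R => y) x 1 x0 dx) derive_id.
by rewrite /GRing.scale/= mulr1.
Qed.

Lemma is_derive_comp1 (R : realType) (f g : R -> R) (x a b c : R) :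
  is_derive (g x) 1 f a -> is_derive x 1 g b -> a * b = c ->
  is_derive x 1 (fun y => f (g y)) c.
Proof. by move=> fa gb <-; exact: is_derive1_comp. Qed.

Lemma is_derive_gauss_time (R : realType) (d : nat) (z y : 'rV[R]_d) (a s : R) :
  0 < a + s ->
  is_derive s 1 (fun s => gauss_kernel z y (a + s))
    (gauss_kernel z y (a + s) *
     (sqdist z y / (4 * (a + s) ^+ 2) - d%:R / (2 * (a + s)))).
Proof.
move=> as0; set q := sqdist z y.
have dg : is_derive (a + s) 1
    (fun sigma => - (d%:R / 2) * ln sigma - q / 4 * sigma^-1)
    (- (d%:R / 2) * (a + s)^-1 - q / 4 * (- (a + s) ^- 2)).
  have dln := is_derive1_ln as0.
  have dinv := is_derive_inv1 _ _ (lt0r_neq0 as0).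
  by apply: is_deriveB; exact: is_derive_mull.
have dk := is_derive_comp1 _ expR _ _ _ _ _ (is_derive_expR _) dg erefl.
have ds : is_derive s 1 (fun s => a + s) (0 + 1) by exact: is_deriveD.
apply: (is_derive_comp1 _ _ _ _ _ _ _ dk ds).
rewrite add0r mulr1; congr (_ * _); field.
by rewrite gt_eqF.
Qed.

Lemma deriv2_at0_gauss1 (R : realType) (c k u : R) :
  deriv2_at0 (fun h : R => expR (c - (u + h) ^+ 2 * k))
    (expR (c - u ^+ 2 * k) * (4 * (u * k) ^+ 2 - 2 * k)).
Proof.
have dlin (h : R) : is_derive h 1 (fun h : R => u + h) 1.
  have := is_deriveD (is_derive_cst u h 1) (is_derive_id h (1 : R)).
  by rewrite add0r.
have dpoly (h : R) : is_derive h 1 (fun h : R => c - (u + h) ^+ 2 * k) (- 2 * k * (u + h)).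
  have dsq := is_derive_mull _ k _ _ _ (is_deriveM (dlin h) (dlin h)).
  have := is_deriveB (is_derive_cst c h 1) dsq.
  have -> : (cst c - (fun h0 : R => k * ((fun h => u + h) * (fun h => u + h)) h0)) =
            (fun h : R => c - (u + h) ^+ 2 * k).
    apply/funext => h'; transitivity (c - k * ((u + h') * (u + h'))) => //.
    by rewrite expr2 [k * _]mulrC.
  by move/is_derive_eq; apply; rewrite /GRing.scale/=; ring.
have dexp (h : R) : is_derive h 1 (fun h : R => expR (c - (u + h) ^+ 2 * k))
    (expR (c - (u + h) ^+ 2 * k) * (- 2 * k * (u + h))).
  exact: (is_derive_comp1 _ expR _ _ _ _ _ (is_derive_expR _) (dpoly h) erefl).
exists (fun h => expR (c - (u + h) ^+ 2 * k) * (- 2 * k * (u + h))).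
  by near=> h; exact: dexp.
have := is_deriveM (dexp 0) (is_derive_mull _ (- 2 * k) _ _ _ (dlin 0)).
by move/is_derive_eq; apply; rewrite /GRing.scale/= addr0; ring.
Unshelve. all: by end_near. Qed.

Lemma deriv2_at0_gauss (R : realType) (d : nat) (z y : 'rV[R]_d) (sigma : R) (i : 'I_d) :
  0 < sigma ->
  deriv2_at0 (fun h : R => gauss_kernel z (y + h *: delta_mx ord0 i) sigma)
    (gauss_kernel z y sigma *
     ((y ord0 i - z ord0 i) ^+ 2 / (4 * sigma ^+ 2) - (2 * sigma)^-1)).
Proof.
move=> s0; pose u := y ord0 i - z ord0 i.
pose c := - (d%:R / 2) * ln sigma -
  (\sum_(j < d | j != i) (y ord0 j - z ord0 j) ^+ 2) / 4 * sigma^-1.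
have E h : gauss_kernel z (y + h *: delta_mx ord0 i) sigma =
    expR (c - (u + h) ^+ 2 * (4 * sigma)^-1).
  rewrite /gauss_kernel; congr expR; rewrite /c /sqdist (bigD1 i)//= !mxE !eqxx.
  rewrite mulr1 (eq_bigr (fun j => (y ord0 j - z ord0 j) ^+ 2)); last first.
    by move=> j ji; rewrite !mxE (negbTE ji) andbF mulr0 addr0.
  rewrite /u; field.
  by rewrite gt_eqF.
under eq_fun do rewrite E.
have -> : gauss_kernel z y sigma = expR (c - u ^+ 2 * (4 * sigma)^-1).
  by have := E 0; rewrite scale0r !addr0.
have := deriv2_at0_gauss1 _ c (4 * sigma)^-1 u.
congr (deriv2_at0 _ (_ * _)); rewrite /u; field.
by rewrite gt_eqF.
Qed.

(** The heat equation: the sum of the second derivatives of deriv2_at0_gauss is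
    the time derivative of is_derive_gauss_time. *)
Lemma gauss_kernel_heat (R : realType) (d : nat) (z y : 'rV[R]_d) (sigma : R) :
  0 < sigma ->
  \sum_(i < d) gauss_kernel z y sigma *
     ((y ord0 i - z ord0 i) ^+ 2 / (4 * sigma ^+ 2) - (2 * sigma)^-1) =
  gauss_kernel z y sigma * (sqdist z y / (4 * sigma ^+ 2) - d%:R / (2 * sigma)).
Proof.
move=> s0; rewrite -mulr_sumr; congr (_ * _).
by rewrite big_split/= -mulr_suml sumr_const card_ord mulNrn -[_^-1 *+ d]mulr_natl.
Qed.

Lemma continuous_gauss (R : realType) (d : nat) (z y : 'rV[R]_d) (a s : R) :
  0 < a + s ->
  {for (y, s), continuous (fun p : 'rV[R]_d * R => gauss_kernel z p.1 (a + p.2))}.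
Proof.
move=> as0.
have cs : (fun p : 'rV[R]_d * R => a + p.2) @ (y, s) --> a + s.
  by apply: cvgD; [exact: cvg_cst|exact: cvg_snd].
apply: (@continuous_comp _ _ _ _ expR); last exact: continuous_expR.
apply: cvgB.
  apply: cvgMr.
  apply: continuous_cvg; [exact: continuous_ln|exact: cs].
apply: cvgM; last by apply: cvgV; [rewrite gt_eqF|].
apply: cvgMl.
apply: cvg_big => [|i _]; first exact: add_continuous.
apply: (@cvg_comp _ _ _ (fun p : 'rV[R]_d * R => p.1 ord0 i - z ord0 i)
  (fun x : R => x ^+ 2) _ (nbhs (y ord0 i - z ord0 i))); last exact: exprn_continuous.
apply: cvgB; last exact: cvg_cst.
apply: (@cvg_comp _ _ _ fst (fun y : 'rV[R]_d => y ord0 i)); first exact: cvg_fst.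
exact: coord_continuous.
Qed.

(** * Grids of cells and Lebesgue measure *)

(** Half-open, so that the cells of a grid are disjoint. *)
Definition cell {R : realType} {d : nat} (z : 'rV[R]_d) (a : R) : set 'rV[R]_d :=
  [set y | forall i, z ord0 i <= y ord0 i < z ord0 i + a].

Lemma measurable_cell (R : realType) (d : nat) (z : 'rV[R]_d) (a : R) :
  measurable (cell z a).
Proof.
have -> : cell z a = \bigcap_(i in [set: 'I_d])
    ((fun y : 'rV[R]_d => y ord0 i) @^-1` `[z ord0 i, z ord0 i + a[%classic).
  apply/seteqP; split => y /= yz i; first by rewrite /= in_itv/=.
  by have := yz i I; rewrite /= in_itv.
apply: fin_bigcap_measurable => // i _.
rewrite -[X in measurable X]setTI.
by apply: measurable_coord.
Qed.

Lemma preimage_rV_cons_cell (R : realType) (d : nat) (z : 'rV[R]_d.+1) (a : R) :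
  rV_cons @^-1` cell z a =
  `[z ord0 ord0, z ord0 ord0 + a[%classic `*` cell (@rsubmx R 1 1 d z) a.
Proof.
have hd (p : R * 'rV[R]_d) : rV_cons p ord0 ord0 = p.1.
  by rewrite -[RHS](congr1 fst (rV_consK p)).
have tl (p : R * 'rV[R]_d) (j : 'I_d) : rV_cons p ord0 (rshift 1 j) = p.2 ord0 j.
  by rewrite /rV_cons (@row_mxEr _ _ 1 d).
apply/seteqP; split => p /= H.
  split; first by have := H ord0; rewrite hd in_itv.
  by move=> j; have := H (rshift 1 j); rewrite tl mxE.
case: H => H1 H2 i; case: (@splitP 1 d i) => j ij.
  have -> : i = ord0 by apply/val_inj; rewrite /= ij; case: j {ij} => -[].
  by rewrite hd; move: H1; rewrite in_itv.
have -> : i = rshift 1 j by apply/val_inj.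
by have := H2 j; rewrite tl mxE.
Qed.

Lemma lebesgue_rV_cell (R : realType) (d : nat) (z : 'rV[R]_d) (a : R) :
  0 <= a -> lebesgue_rV d (cell z a) = (a ^+ d)%:E.
Proof.
move=> a0; elim: d z => [|d IH] z.
  by rewrite /= expr0 diracE mem_set// => -[].
rewrite /= /lebesgue_rV_step /= /pushforward preimage_rV_cons_cell.
rewrite product_measure1E//; last exact: measurable_cell.
rewrite IH exprS EFinM; congr (_ * _)%E.
have := lebesgue_measure_itv `[z ord0 ord0, z ord0 ord0 + a[; rewrite /= lte_fin ltrDl => ->.
case: ifPn => [a0'|]; last first.
  by rewrite -leNgt => a0'; congr EFin; apply/eqP; rewrite eq_le a0 a0'.
by rewrite -EFinD addrAC subrr add0r.
Qed.

Lemma ge0_sum_integral_le d (T : measurableType d) (R : realType)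
    (mu : {measure set T -> \bar R}) (I : finType) (F : I -> set T) (B : set T)
    (f : T -> \bar R) :
  (forall i, measurable (F i)) -> trivIset [set: I] F -> measurable B ->
  (forall i, F i `<=` B) -> measurable_fun B f -> (forall x, B x -> (0 <= f x)%E) ->
  (\sum_(i : I) \int[mu]_(x in F i) f x <= \int[mu]_(x in B) f x)%E.
Proof.
move=> mF tF mB FB mf f0.
have UB : \big[setU/set0]_(i <- index_enum I) F i `<=` B.
  by rewrite -bigcup_seq; apply: bigcup_sub => i _; exact: FB.
rewrite -ge0_integral_bigsetU//.
- apply: ge0_subset_integral => //; exact: bigsetU_measurable.
- exact: index_enum_uniq.
- exact: sub_trivIset tF.
- exact: measurable_funS mf.
- by move=> x /UB; exact: f0.
Qed.

(** With weight |w| + 1 at the corner of each cell of a fine grid, the step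
    function dominates |w|, and it is at most |w| + 2 <= w^2 + 3; integrating
    over the box bounds its integral. The crude additive constants are harmless
    because the estimate is applied to normalized functions only. *)
Lemma cell_cover (R : realType) (d : nat) (w : 'rV[R]_d -> R) (L delta : R) :
  0 < L -> 0 < delta -> measurable_fun setT w ->
  (\int[lebesgue_rV d]_x (w x ^+ 2)%:E <= 1)%E ->
  (forall y z : 'rV[R]_d, (forall i, `|y ord0 i| <= L) ->
     (forall i, `|y ord0 i - z ord0 i| <= delta) -> `|w y - w z| <= 1) ->
  exists (a : R) (I : finType) (z : I -> 'rV[R]_d) (m : I -> R),
  [/\ 0 < a, forall j, 0 <= m j,
      forall y : 'rV[R]_d, (forall i, - L <= y ord0 i < L) ->
        exists2 j, `|w y| <= m j & forall i, `|y ord0 i - z j ord0 i| <= a &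
      \sum_j m j * a ^+ d <= 1 + 3 * (2 * L) ^+ d].
Proof.
move=> L0 dl0 mw w2 osc.
pose N := (Num.truncn (2 * L / delta)).+1.
have N0 : 0 < N%:R :> R by rewrite ltr0n.
pose a := 2 * L / N%:R.
have a0 : 0 < a by rewrite divr_gt0//; lra.
have aN : a * N%:R = 2 * L by rewrite /a divfK// gt_eqF.
have ad : a <= delta.
  have /truncn_itv/andP[_ /ltW] : 0 <= 2 * L / delta by rewrite divr_ge0//; lra.
  by rewrite ler_pdivrMr// => H; rewrite /a ler_pdivrMr// [delta * _]mulrC.
pose I := {ffun 'I_d -> 'I_N}.
pose z (j : I) : 'rV[R]_d := \row_i (- L + a * (j i)%:R).
have zE (j : I) i : z j ord0 i = - L + a * (j i)%:R by rewrite mxE.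
pose m (j : I) := `|w (z j)| + 1.
have in_box (j : I) (y : 'rV[R]_d) : cell (z j) a y -> forall i, - L <= y ord0 i < L.
  move=> yj i; have := yj i; rewrite zE => /andP[y1 y2].
  have : a * (j i)%:R + a <= 2 * L.
    by rewrite -[X in _ + X]mulr1 -mulrDr natr1 -aN ler_pM2l// ler_nat.
  have : 0 <= a * (j i)%:R by rewrite mulr_ge0// ltW.
  lra.
exists a, ({ffun 'I_d -> 'I_N} : finType), z, m.
split => //.
- by move=> j; rewrite addr_ge0.
- move=> y yL.
  have yt i : 0 <= (y ord0 i + L) / a.
    by rewrite divr_ge0// ?(ltW a0)//; have := yL i; lra.
  have tN i : (Num.truncn ((y ord0 i + L) / a) < N)%N.
    have /truncn_itv/andP[t1 _] := yt i.
    rewrite -(ltr_nat R); apply: le_lt_trans t1 _.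
    by rewrite ltr_pdivrMr// mulrC aN; have := yL i; lra.
  pose j : I := [ffun i => Ordinal (tN i)].
  have yz i : `|y ord0 i - z j ord0 i| <= a.
    rewrite zE ffunE /=; have /truncn_itv/andP[] := yt i.
    set k := Num.truncn _; rewrite ler_pdivlMr// ltr_pdivrMr// -natr1 mulrDl mul1r => t1 t2.
    by rewrite ler_norml; move: t1 t2; rewrite [_ * a]mulrC; lra.
  exists j => //.
  have : `|w y - w (z j)| <= 1.
    apply: osc => i; first by rewrite ler_norml; have := yL i; lra.
    exact: le_trans (yz i) ad.
  rewrite /m => H; have := ler_normD (w (z j)) (w y - w (z j)).
  rewrite addrCA subrr addr0; lra.
pose f (x : 'rV[R]_d) := (w x ^+ 2 + 3)%:E.
pose B : set 'rV[R]_d := cell (const_mx (- L)) (2 * L).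
have BE y : B y <-> forall i, - L <= y ord0 i < L.
  by split => H i; have := H i; rewrite mxE; lra.
have mfT : measurable_fun setT f.
  apply/measurable_EFinP.
  by apply: measurable_funD => //; exact: measurable_funX.
have f0 x : (0 <= f x)%E by rewrite lee_fin addr_ge0// sqr_ge0.
have tF : trivIset [set: I] (fun j => cell (z j) a).
  apply/trivIsetP => /= j k _ _ /eqP jk; apply/seteqP; split => // y [yj yk].
  apply: jk; apply/ffunP => i; apply/val_inj => /=.
  have := yj i; have := yk i; rewrite !zE => /andP[k1 k2] /andP[j1 j2].
  have lt1 (p q : nat) : a * p%:R < a * q%:R + a -> (p <= q)%N.
    by rewrite -[X in _ + X]mulr1 -mulrDr ltr_pM2l// natr1 ltr_nat ltnS.
  by apply/eqP; rewrite eqn_leq !lt1//; lra.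
have cellB j : cell (z j) a `<=` B by move=> y yj; apply/BE; exact: in_box yj.
have := @ge0_sum_integral_le _ _ _ (lebesgue_rV d) I _ B f
  (fun j => measurable_cell _ _ (z j) a) tF (measurable_cell _ _ _ _) cellB
  (measurable_funTS mfT) (fun x _ => f0 x).
rewrite -lee_fin => H; apply: (le_trans (le_trans _ H)).
  rewrite -sumEFin; apply: lee_sum => j _.
  have -> : (m j * a ^+ d)%:E = (\int[lebesgue_rV d]_(x in cell (z j) a) (m j)%:E)%E.
    rewrite integral_cst; last exact: measurable_cell.
    rewrite EFinM; congr (_ * _)%E; apply/esym.
    exact: (lebesgue_rV_cell _ _ (z j) _ (ltW a0)).
  apply: ge0_le_integral => //.
  - exact: measurable_cell.
  - by move=> x _; rewrite lee_fin addr_ge0.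
  - exact: measurable_funTS.
  - move=> x xj; rewrite lee_fin /m.
    have : `|w x - w (z j)| <= 1.
      apply: osc => i; first by rewrite ler_norml; have := in_box _ _ xj i; lra.
      by apply: le_trans ad; have := xj i; rewrite ler_norml; lra.
    move=> H'; have := ler_normD (w x) (w (z j) - w x).
    rewrite addrCA subrr addr0 distrC.
    have : 2 * `|w x| <= w x ^+ 2 + 1.
      by have := sqr_ge0 (`|w x| - 1); rewrite sqrrB real_normK ?num_real//; lra.
    by have := normr_ge0 (w x); lra.
have -> : (\int[lebesgue_rV d]_(x in B) f x =
   \int[lebesgue_rV d]_(x in B) ((w x ^+ 2)%:E + 3%:E))%E by apply: eq_integral.
rewrite ge0_integralD//; last 3 first.
- exact: measurable_cell.
- by move=> x _; rewrite lee_fin sqr_ge0.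
- by apply: measurable_funTS; apply/measurable_EFinP; exact: measurable_funX.
rewrite [leRHS]EFinD; apply: leeD.
  apply: le_trans w2; apply: ge0_subset_integral => //.
  - exact: measurable_cell.
  - by apply/measurable_EFinP; exact: measurable_funX.
  - by move=> x _; rewrite lee_fin sqr_ge0.
rewrite integral_cst; last exact: measurable_cell.
have L2 : 0 <= 2 * L by lra.
rewrite [leRHS]EFinM -(lebesgue_rV_cell R d (const_mx (- L)) (2 * L) L2).
exact: lexx.
Qed.

(** * The Hilbert space structure of L2 *)

Section L2_theory.
Context {R : realType} {d : nat} (Omega : set 'rV[R]_d).
Implicit Types (v w : 'rV[R]_d -> R).

Lemma L2_measurable v : L2 Omega v -> measurable_fun setT (v \_ Omega).
Proof. by move/sub_Lfun_mfun; rewrite inE. Qed.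

Lemma restrict_lincomb (a : R) v w :
  (fun x => a * v x + w x) \_ Omega = (fun x => a * (v \_ Omega) x + (w \_ Omega) x).
Proof.
by apply/funext => x; rewrite !patchE; case: ifPn => // _; rewrite mulr0 addr0.
Qed.

Lemma L2_lincomb (a : R) v w : L2 Omega v -> L2 Omega w ->
  L2 Omega (fun x => a * v x + w x).
Proof.
move=> Lv Lw; rewrite /L2 restrict_lincomb.
have L12 : (1 <= 2%:E :> \bar R)%E by rewrite lee_fin; lra.
exact: (@Lfun_submod_closed _ _ _ _ _ L12).2.
Qed.

Lemma L2_zero : L2 Omega (fun=> 0).
Proof.
have L12 : (1 <= 2%:E :> \bar R)%E by rewrite lee_fin; lra.
rewrite /L2; have -> : (fun=> 0 : R) \_ Omega = 0.
  by apply/funext => x; rewrite patchE; case: ifPn.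
exact: (@Lfun_submod_closed _ _ _ _ _ L12).1.
Qed.

Lemma L2_sum n (c : nat -> R) (phi : nat -> 'rV[R]_d -> R) :
  (forall k, L2 Omega (phi k)) -> L2 Omega (fun x => \sum_(k < n) c k * phi k x).
Proof.
move=> Lphi; elim: n => [|n IH].
  have -> : (fun x => \sum_(k < 0) c k * phi k x) = (fun=> 0).
    by apply/funext => x; rewrite big_ord0.
  exact: L2_zero.
have -> : (fun x => \sum_(k < n.+1) c k * phi k x) =
          (fun x => c n * phi n x + \sum_(k < n) c k * phi k x).
  by apply/funext => x; rewrite big_ord_recr /= addrC.
exact: L2_lincomb.
Qed.

Lemma L2inner_restrict v w :
  L2inner Omega v w = (\int[lebesgue_rV d]_x ((v \_ Omega) x * (w \_ Omega) x))%R.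
Proof.
rewrite /L2inner Rintegral_mkcond; apply: eq_Rintegral => x _.
by rewrite !patchE; case: ifPn => // _; rewrite mul0r.
Qed.

Lemma L2_integrable_mul v w : L2 Omega v -> L2 Omega w ->
  (lebesgue_rV d).-integrable setT (EFin \o (fun x => (v \_ Omega) x * (w \_ Omega) x)).
Proof. by move=> Lv Lw; apply/Lfun1_integrable; exact: Lfun2_mul_Lfun1. Qed.

Lemma L2innerC v w : L2inner Omega v w = L2inner Omega w v.
Proof. by apply: eq_Rintegral => x _; rewrite mulrC. Qed.

Lemma L2inner_lincomb (a : R) v w u : L2 Omega v -> L2 Omega w -> L2 Omega u ->
  L2inner Omega (fun x => a * v x + w x) u = a * L2inner Omega v u + L2inner Omega w u.
Proof.
move=> Lv Lw Lu; rewrite !L2inner_restrict restrict_lincomb.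
have ivu := L2_integrable_mul _ _ Lv Lu; have iwu := L2_integrable_mul _ _ Lw Lu.
rewrite -RintegralZl// -RintegralD//.
  by apply: eq_Rintegral => x _; rewrite mulrDl mulrA.
have := integrableZl measurableT a ivu.
by apply: eq_integrable => // x _; rewrite /= EFinM.
Qed.

Lemma L2inner_suml n (c : nat -> R) (phi : nat -> 'rV[R]_d -> R) u :
  (forall k, L2 Omega (phi k)) -> L2 Omega u ->
  L2inner Omega (fun x => \sum_(k < n) c k * phi k x) u =
  \sum_(k < n) c k * L2inner Omega (phi k) u.
Proof.
move=> Lphi Lu; elim: n => [|n IH].
  rewrite big_ord0 L2inner_restrict.
  transitivity (\int[lebesgue_rV d]_(x in setT) (0 : R))%R.
    apply: eq_Rintegral => x _.
    by rewrite patchE; case: ifPn => _; rewrite ?big_ord0 mul0r.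
  by rewrite Rintegral_cst// mul0r.
have -> : (fun x => \sum_(k < n.+1) c k * phi k x) =
          (fun x => c n * phi n x + \sum_(k < n) c k * phi k x).
  by apply/funext => x; rewrite big_ord_recr /= addrC.
rewrite L2inner_lincomb//; last exact: L2_sum.
by rewrite IH big_ord_recr /= addrC.
Qed.

Lemma L2norm_ge0 v : 0 <= L2norm Omega v.
Proof. by rewrite /L2norm fine_ge0// Lnorm_ge0. Qed.

Lemma L2normE v : L2 Omega v ->
  (L2norm Omega v)%:E = 'N[lebesgue_rV d]_2%:E[EFin \o (v \_ Omega)]%E.
Proof.
move=> /sub_Lfun_finLfun; rewrite inE /= => fv.
by rewrite /L2norm fineK// ge0_fin_numE// Lnorm_ge0.
Qed.

Lemma L2norm_sqr v : L2 Omega v -> L2norm Omega v ^+ 2 = L2inner Omega v v.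
Proof.
move=> Lv; apply: EFin_inj.
have iv := L2_integrable_mul _ _ Lv Lv.
rewrite L2inner_restrict fineK; last exact: integrable_fin_num.
have -> : ((L2norm Omega v ^+ 2)%:E = (L2norm Omega v)%:E `^ 2)%E.
  by rewrite -powR_mulrn ?L2norm_ge0.
rewrite L2normE// poweR_Lnorm//.
apply: eq_integral => x _; set y := (v \_ Omega) x.
transitivity ((`|y| `^ 2)%:E) => //.
by rewrite powR_mulrn// real_normK ?num_real.
Qed.

Lemma L2norm_triangle v w : L2 Omega v -> L2 Omega w ->
  L2norm Omega v <= L2norm Omega (fun x => v x - w x) + L2norm Omega w.
Proof.
move=> Lv Lw.
have Lvw : L2 Omega (fun x => v x - w x).
  have := L2_lincomb (-1) _ _ Lw Lv; congr (L2 Omega _).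
  by apply/funext => x; rewrite mulN1r addrC.
rewrite -lee_fin EFinD !L2normE//.
have := @eminkowski _ _ _ (lebesgue_rV d) ((fun x => v x - w x) \_ Omega) (w \_ Omega) 2%:E.
move=> /(_ (L2_measurable _ Lvw) (L2_measurable _ Lw)).
have L12 : (1 <= 2%:E :> \bar R)%E by rewrite lee_fin; lra.
move=> /(_ L12); congr (_ <= _)%E; congr ('N[_]__[_])%E.
apply/funext => x /=; congr EFin; rewrite !patchE.
by case: ifPn => _; rewrite ?subrK ?addr0.
Qed.

Lemma L2norm_sum_sqr n (c : nat -> R) (phi : nat -> 'rV[R]_d -> R) :
  (forall k, L2 Omega (phi k)) ->
  (forall j k, L2inner Omega (phi j) (phi k) = (j == k)%:R) ->
  L2norm Omega (fun x => \sum_(k < n) c k * phi k x) ^+ 2 = \sum_(k < n) c k ^+ 2.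
Proof.
move=> Lphi ortho; have Ls := L2_sum n c phi Lphi.
rewrite L2norm_sqr// L2inner_suml//; apply: eq_bigr => j _.
rewrite L2innerC L2inner_suml// (bigD1 j)//= ortho eqxx mulr1 big1 ?addr0 ?expr2//.
move=> k kj; rewrite ortho; have -> : (k == j :> nat) = false by apply/negbTE.
by rewrite mulr0.
Qed.

End L2_theory.

(** * Smoothing of the heat semigroup *)

(** Uniform continuity on a compact box, by a covering argument; the second
    point may lie outside the box, as happens for corners of cells. *)
Lemma uniform_modulus (R : realType) (d : nat) (w : 'rV[R]_d -> R) (L : R) :
  continuous w ->
  exists2 delta : R, 0 < delta & forall y z : 'rV[R]_d,
    (forall i, `|y ord0 i| <= L) -> (forall i, `|y ord0 i - z ord0 i| <= delta) ->
    `|w y - w z| <= 1.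
Proof.
move=> cw.
pose box := [set v : 'rV[R]_d | forall i, `[- L, L]%classic (v ord0 i)].
have cbox : compact box.
  by apply: (@rV_compact _ _ (fun=> `[- L, L]%classic)) => _; exact: segment_compact.
pose P (delta : R) (y : 'rV[R]_d) := forall z : 'rV[R]_d,
  (forall i, `|y ord0 i - z ord0 i| <= delta) -> `|w y - w z| <= 1.
have : \forall delta \near (0 : R)^'+, box `<=` P delta.
  move/compact_near_coveringP : cbox; apply.
  move=> x _.
  have /nbhs_ballP[r /= r0 Hr] : nbhs x [set y | `|w x - w y| < 1 / 2].
    have /cvgrPdist_lt := cw x; apply; lra.
  have xr (y : 'rV[R]_d) : (forall i, `|x ord0 i - y ord0 i| < r) -> `|w x - w y| < 1 / 2.
    move=> H; apply: Hr; split => // i j; rewrite (ord1 i); exact: H.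
  have r20 : 0 < r / 2 by rewrite divr_gt0.
  (* halving r leaves room for a perturbation of the centre *)
  exists (ball x (r / 2), [set e : R | 0 < e < r / 2]) => /=.
    split; first exact: nbhsx_ballx.
    near=> e; rewrite /=; apply/andP; split.
      by near: e; exact: nbhs_right_gt.
    by near: e; exact: nbhs_right_lt.
  move=> [x' e] /= [[_ xx'] /andP[e0 er]] z zx'.
  have xx'i i : `|x ord0 i - x' ord0 i| < r / 2 by exact: xx'.
  have w1 : `|w x - w x'| < 1 / 2 by apply: xr => i; apply: lt_trans (xx'i i) _; lra.
  have w2 : `|w x - w z| < 1 / 2.
    apply: xr => i; have := ler_distD (x' ord0 i) (x ord0 i) (z ord0 i).
    have := zx' i; have := xx'i i; lra.
  have := ler_distD (w x) (w x') (w z); rewrite (distrC (w x') (w x)); lra.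
move=> H.
have [e [e0 He]] : exists e : R, 0 < e /\ box `<=` P e.
  near (0 : R)^'+ => e; exists e; split; first by near: e; exact: nbhs_right_gt.
  by near: e.
exists e => // y z yL; apply: He => i; rewrite /= in_itv/= -ler_norml; exact: yL.
Unshelve. all: by end_near. Qed.

(** Taking the time equal to the square of the side of the cell makes the bound
    scale invariant: the dimensional constant expR (d / 4) pays for the distance
    to the corner. *)
Lemma gauss_kernel_cell (R : realType) (d : nat) (z y : 'rV[R]_d) (a : R) :
  0 < a -> (forall i, `|y ord0 i - z ord0 i| <= a) ->
  1 <= expR (d%:R / 4) * (a ^+ d * gauss_kernel z y (a ^+ 2)).
Proof.
move=> a0 yz.
have q_le : sqdist z y <= d%:R * a ^+ 2.
  rewrite -[d in d%:R]card_ord -sum1_card natr_sum mulr_suml; apply: ler_sum => i _.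
  by rewrite mul1r -[X in X <= _]real_normK ?num_real// lerXn2r// ?nnegrE// ltW.
have -> : a ^+ d = expR (d%:R * ln a) by rewrite mulr_natl -lnXn// lnK// posrE exprn_gt0.
rewrite /gauss_kernel lnXn// -!expRD -[leLHS]expR0 ler_expR.
rewrite -mulr_natl.
have : sqdist z y / 4 * (a ^+ 2)^-1 <= d%:R / 4.
  by rewrite ler_pdivrMr ?exprn_gt0// mulrAC ler_pM2r ?invr_gt0.
move: (sqdist z y / 4 * (a ^+ 2)^-1) => q. lra.
Qed.

Lemma gauss_kernel_le (R : realType) (d : nat) (z y : 'rV[R]_d) (a t : R) :
  0 <= a -> 0 < t -> gauss_kernel z y (a + t) <= expR (- (d%:R / 2) * ln t).
Proof.
move=> a0 t0; have at0 : 0 < a + t by lra.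
rewrite /gauss_kernel ler_expR.
have : 0 <= sqdist z y / 4 * (a + t)^-1.
  rewrite !mulr_ge0// ?invr_ge0 ?(ltW at0)//.
  by apply: sumr_ge0 => i _; exact: sqr_ge0.
have : d%:R / 2 * ln t <= d%:R / 2 * ln (a + t).
  by rewrite ler_wpM2l// ler_ln ?posrE//; lra.
lra.
Qed.

Definition heat_smoothing_const {R : realType} (d : nat) (L : R) : R :=
  expR (d%:R / 4) * (1 + 3 * (2 * L) ^+ d).

(** The comparison function V is a sum of Gaussians with initial time a^2, a
    being the side of the cells, so that V dominates the initial value cell by
    cell; at time t its Gaussians are at most t^(-d/2). *)
Lemma heat_smoothing (R : realType) (d : nat) (Omega : set 'rV[R]_d) (L : R)
    (lam : nat -> R) (phi : nat -> 'rV[R]_d -> R) (n : nat) (c : nat -> R)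
    (t : R) (x : 'rV[R]_d) :
  open Omega -> 0 < L -> (forall y i, Omega y -> `|y ord0 i| < L) ->
  dirichlet_eigenbasis Omega lam phi ->
  \sum_(k < n) c k ^+ 2 <= 1 -> 0 < t -> Omega x ->
  \sum_(k < n) c k * expR (- lam k * t) * phi k x <=
    heat_smoothing_const d L * expR (- (d%:R / 2) * ln t).
Proof.
move=> oO L0 OL deb c1 t0 Ox.
pose psi k := phi k \_ Omega.
have psiE k y : Omega y -> psi k y = phi k y by move=> Oy; rewrite /psi patchE mem_set.
have psi0 k y : ~ Omega y -> psi k y = 0 by move=> nOy; rewrite /psi patchE memNset.
have cpsi k : continuous (psi k).
  have [Ck2 cphi _ phi0] := deb_eigen deb k.
  apply: continuous_zero_extension => //.
  move=> s y Oy; have [h1 h2] := Ck2 s y Oy.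
  by split=> [sk|//]; apply: h1; exact: leq_trans sk _.
pose W y := \sum_(k < n) c k * psi k y.
have WE : W = (fun y => \sum_(k < n) c k * phi k y) \_ Omega.
  apply/funext => y; rewrite patchE; case: ifPn => [|].
    by rewrite inE => Oy; apply: eq_bigr => k _; rewrite psiE.
  by rewrite notin_setE => nOy; rewrite /W big1// => k _; rewrite psi0// mulr0.
have LW := L2_sum Omega n c phi (deb_L2 deb).
have mW : measurable_fun setT W by rewrite WE; exact: L2_measurable.
have W2 : (\int[lebesgue_rV d]_y (W y ^+ 2)%:E <= 1)%E.
  have := L2norm_sum_sqr Omega n c phi (deb_L2 deb) (deb_orthonormal deb).
  rewrite L2norm_sqr// L2inner_restrict -WE => E.
  have iW := L2_integrable_mul _ _ _ LW LW; rewrite -WE in iW.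
  have : (\int[lebesgue_rV d]_y (W y * W y)%:E)%E = (\sum_(k < n) c k ^+ 2)%:E.
    by rewrite -E fineK//; exact: integrable_fin_num.
  by move=> {}E; under eq_integral do rewrite expr2; rewrite E lee_fin.
have cW : continuous W.
  move=> y; have Fy := nbhs_filter y; apply: cvg_big => [|k _]; first exact: add_continuous.
  by apply: cvgMr; exact: cpsi.
have [delta dl0 osc] := uniform_modulus _ _ W L cW.
have [a [I [z [m [a0 m0 cover msum]]]]] := cell_cover _ _ W L delta L0 dl0 mW W2 osc.
pose A := expR (d%:R / 4 : R).
pose V y s := \sum_(j : I) m j * a ^+ d * gauss_kernel (z j) y (a ^+ 2 + s).
pose U y s := \sum_(k < n) c k * expR (- lam k * s) * psi k y.
pose D y s := U y s + (- A) * V y s.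
have a20 : 0 < a ^+ 2 by rewrite exprn_gt0.
have V0 y s : 0 <= V y s.
  by apply: sumr_ge0 => j _; rewrite !mulr_ge0 ?expR_ge0 ?exprn_ge0// ltW.
have A0 : 0 < A by exact: expR_gt0.
have D0 : D x t <= 0.
  apply: (@parabolic_max_principle R d Omega L D t).
  - by move=> y i Oy; apply/ltW/OL.
  - move=> y s /andP[s0 _]; have Fys := nbhs_filter (y, s).
    apply: cvgD.
      apply: cvg_big => [|k _]; first exact: add_continuous.
      apply: cvgM.
        apply: cvgMr.
        apply: (@cvg_comp _ _ _ (fun p : 'rV[R]_d * R => - lam k * p.2) expR _
           (nbhs (- lam k * s))); last exact: continuous_expR.
        by apply: cvgMr; exact: cvg_snd.
      apply: (@cvg_comp _ _ _ fst (psi k)); first exact: cvg_fst.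
      exact: cpsi.
    apply: cvgMr.
    apply: cvg_big => [|j _]; first exact: add_continuous.
    apply: cvgMr.
    by apply: continuous_gauss; lra.
  - move=> y s nOy _; rewrite /D /U big1 ?add0r; last by move=> k _; rewrite psi0// mulr0.
    by rewrite mulNr oppr_le0 mulr_ge0// ltW.
  - move=> y; rewrite /D mulNr subr_le0.
    have -> : U y 0 = W y.
      by apply: eq_bigr => k _; rewrite mulr0 expR0 mulr1.
    have [Oy|nOy] := pselect (Omega y); last first.
      rewrite /W big1; last by move=> k _; rewrite psi0// mulr0.
      by rewrite mulr_ge0// ltW.
    have [|j Wm yz] := cover y.
      by move=> i; have := OL y i Oy; rewrite ltr_norml; lra.
    apply: le_trans (ler_norm _) _; apply: le_trans Wm _.
    have K1 := gauss_kernel_cell _ _ (z j) y a a0 yz.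
    apply: (@le_trans _ _ (A * (m j * a ^+ d * gauss_kernel (z j) y (a ^+ 2 + 0)))).
      rewrite addr0 -mulrA mulrCA -[leLHS]mulr1 ler_wpM2l//.
    rewrite ler_pM2l// /V (bigD1 j)//= lerDl sumr_ge0// => i _.
    by rewrite !mulr_ge0 ?expR_ge0 ?exprn_ge0// ltW.
  - move=> y s Oy /andP[s0 _].
    have as0 : 0 < a ^+ 2 + s by lra.
    exists (\sum_(k < n) c k * (expR (- lam k * s) * - lam k) * psi k y +
      - A * \sum_(j : I) m j * a ^+ d * (gauss_kernel (z j) y (a ^+ 2 + s) *
        (sqdist (z j) y / (4 * (a ^+ 2 + s) ^+ 2) - d%:R / (2 * (a ^+ 2 + s))))).
    exists (fun i => \sum_(k < n) c k * expR (- lam k * s) * partial i (partial i (phi k)) y +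
      - A * \sum_(j : I) m j * a ^+ d * (gauss_kernel (z j) y (a ^+ 2 + s) *
        ((y ord0 i - z j ord0 i) ^+ 2 / (4 * (a ^+ 2 + s) ^+ 2) - (2 * (a ^+ 2 + s))^-1))).
    split.
    + apply: is_deriveD.
        apply: is_derive_bigsum => k.
        have dlin : is_derive s 1 (fun s : R => - lam k * s) (- lam k * 1).
          exact: is_derive_mull.
        have dexp := is_derive_comp1 _ expR _ _ _ _ _ (is_derive_expR _) dlin erefl.
        have := is_derive_mull _ (psi k y * c k) _ _ _ dexp.
        rewrite mulr1; congr (is_derive _ _ _ _).
          by apply/funext => r; ring.
        by ring.
      apply: is_derive_mull; apply: is_derive_bigsum => j.
      by apply: is_derive_mull; exact: is_derive_gauss_time.
    + move=> i; apply: deriv2_at0D.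
        apply: deriv2_at0_bigsum => k; apply: deriv2_at0Z.
        by apply: deriv2_at0_partial => //; have [] := deb_eigen deb k.
      apply: deriv2_at0Z; apply: deriv2_at0_bigsum => j; apply: deriv2_at0Z.
      exact: deriv2_at0_gauss.
    + rewrite big_split /= -mulr_sumr.
      rewrite le_eqVlt; apply/orP; left; apply/eqP; congr (_ + _ * _).
        rewrite exchange_big /=; apply: eq_bigr => k _; rewrite -mulr_sumr.
        have [_ _ eig _] := deb_eigen deb k.
        have := eig y Oy; rewrite /laplacian => /eqP; rewrite eqr_oppLR => /eqP ->.
        by rewrite psiE//; ring.
      rewrite exchange_big /=; apply: eq_bigr => j _; rewrite -mulr_sumr; congr (_ * _).
      by rewrite gauss_kernel_heat.
  - by rewrite lexx ltW.
move: D0; rewrite /D mulNr subr_le0.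
have -> : U x t = \sum_(k < n) c k * expR (- lam k * t) * phi k x.
  by apply: eq_bigr => k _; rewrite psiE.
move=> /le_trans; apply; rewrite /heat_smoothing_const -mulrA ler_pM2l//.
rewrite mulrC; apply: le_trans (_ : _ <= expR (- (d%:R / 2) * ln t) * \sum_j m j * a ^+ d) _.
  rewrite mulr_sumr; apply: ler_sum => j _; rewrite mulrC ler_wpM2r//.
    by rewrite mulr_ge0// exprn_ge0// ltW.
  by apply: gauss_kernel_le => //; exact: ltW.
by rewrite ler_wpM2l// expR_ge0.
Qed.

(** * Weighted sums of squares of eigenfunctions *)

(** Duality: choose the coefficients in heat_smoothing proportional to the
    terms exp(-lam_k t) phi_k(x) themselves. *)
Lemma heat_kernel_diagonal (R : realType) (d : nat) (Omega : set 'rV[R]_d) (L : R)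
    (lam : nat -> R) (phi : nat -> 'rV[R]_d -> R) (n : nat) (t : R) (x : 'rV[R]_d) :
  open Omega -> 0 < L -> (forall y i, Omega y -> `|y ord0 i| < L) ->
  dirichlet_eigenbasis Omega lam phi -> 0 < t -> Omega x ->
  \sum_(k < n) (expR (- lam k * t) * phi k x) ^+ 2 <=
    heat_smoothing_const d L ^+ 2 * expR (- d%:R * ln t).
Proof.
move=> oO L0 OL deb t0 Ox.
pose b k := expR (- lam k * t) * phi k x.
set S := \sum_(k < n) _.
have K0 : 0 <= heat_smoothing_const d L.
  by rewrite mulr_ge0 ?expR_ge0// addr_ge0// mulr_ge0// exprn_ge0//; lra.
have S0 : 0 <= S by apply: sumr_ge0 => k _; exact: sqr_ge0.
have -> : heat_smoothing_const d L ^+ 2 * expR (- d%:R * ln t) =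
    (heat_smoothing_const d L * expR (- (d%:R / 2) * ln t)) ^+ 2.
  by rewrite [RHS]exprMn; congr (_ * _); rewrite -expRM_natl; congr expR; field.
have [->|Sn0] := eqVneq S 0; first exact: sqr_ge0.
have S_gt0 : 0 < S by rewrite lt_neqAle eq_sym Sn0.
have sS0 : 0 < Num.sqrt S by rewrite sqrtr_gt0.
rewrite -[leLHS]sqr_sqrtr// lerXn2r// ?nnegrE ?(mulr_ge0 K0 (expR_ge0 _))//.
have c1 : \sum_(k < n) (b k / Num.sqrt S) ^+ 2 <= 1.
  rewrite le_eqVlt; apply/orP; left; apply/eqP.
  rewrite -[RHS](mulfV Sn0) mulr_suml; apply: eq_bigr => k _.
  by rewrite expr_div_n sqr_sqrtr.
have := heat_smoothing R d Omega L lam phi n (fun k => b k / Num.sqrt S) t x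
  oO L0 OL deb c1 t0 Ox.
suff -> : \sum_(k < n) b k / Num.sqrt S * expR (- lam k * t) * phi k x = Num.sqrt S by [].
rewrite -[RHS](mulfK (lt0r_neq0 sS0)) -expr2 sqr_sqrtr// mulr_suml.
by apply: eq_bigr => k _; rewrite /b; ring.
Qed.

Lemma polynomial_le_exp (R : realType) (d m : nat) (eps : R) : 0 < eps -> (0 < m)%N ->
  expR (2 * d%:R * ln (m%:R : R)) <=
  expR (eps * m%:R) * expR (- 2 * d%:R * ln (eps / (2 * d%:R + 1))).
Proof.
(* ln (e m) <= e m, and the denominator 2 d + 1 is positive for d = 0 as well *)
move=> e0 m0; set e := eps / _.
have d0 : 0 <= d%:R :> R by [].
have e'0 : 0 < e by rewrite divr_gt0//; lra.
have mR : 0 < m%:R :> R by rewrite ltr0n.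
rewrite -expRD ler_expR.
have /ltW := @ln_sublinear R (e * m%:R) (mulr_gt0 e'0 mR).
rewrite lnM ?posrE// => H.
have : e * (2 * d%:R) <= eps.
  rewrite /e mulrAC ler_pdivrMr; [nra|lra].
nra.
Qed.

Definition bergman_const {R : realType} (d : nat) (L eps : R) : R :=
  expR (2 * eps + 2) * (heat_smoothing_const d L ^+ 2 *
    (expR (- 2 * d%:R * ln (eps / (2 * d%:R + 1))) / (1 - expR (- eps)))).

(** For each k, the term j of the inner sum with j <= sqrt lam_k < j + 1 has
    exp(-2 lam_k / (j+1)^2) >= exp(-2), so the sum of all terms dominates
    exp(-2 eps sqrt lam_k) up to a constant. Exchanging sums leaves the diagonal
    of the heat kernel at times (j+1)^-2, which grows polynomially in j. *)
Lemma bergman_bound (R : realType) (d : nat) (Omega : set 'rV[R]_d) (L eps : R)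
    (lam : nat -> R) (phi : nat -> 'rV[R]_d -> R) (n : nat) (x : 'rV[R]_d) :
  open Omega -> 0 < L -> (forall y i, Omega y -> `|y ord0 i| < L) ->
  dirichlet_eigenbasis Omega lam phi -> 0 < eps -> Omega x ->
  \sum_(k < n) expR (- 2 * eps * Num.sqrt (lam k)) * phi k x ^+ 2 <=
    bergman_const d L eps.
Proof.
move=> oO L0 OL deb e0 Ox.
(* an index range large enough for the j attached to each k < n *)
pose N := (\max_(k < n) Num.truncn (Num.sqrt (lam k))).+1.
have termk (k : 'I_n) : expR (- 2 * eps * Num.sqrt (lam k)) <=
    expR (2 * eps + 2) * \sum_(j < N) expR (- 2 * eps * j.+1%:R) *
      expR (- lam k * (j.+1%:R ^- 2)) ^+ 2.
  have lk0 : 0 < lam k by exact: deb_pos deb k.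
  have := truncn_itv (sqrtr_ge0 (lam k)); set j := Num.truncn _ => /andP[jl ju].
  have jN : (j < N)%N
    by rewrite ltnS /j; exact: (@leq_bigmax _ (fun k : 'I_n => Num.truncn (Num.sqrt (lam k)))).
  have j0 : 0 < j.+1%:R :> R by rewrite ltr0n.
  rewrite (bigD1 (Ordinal jN))//= mulrDr.
  apply: (@le_trans _ _ (expR (2 * eps + 2) * (expR (- 2 * eps * j.+1%:R) *
      expR (- lam k * (j.+1%:R ^- 2)) ^+ 2))).
    rewrite -expRM_natl -!expRD ler_expR.
    have : lam k * (j.+1%:R ^- 2) <= 1.
      rewrite ler_pdivrMr ?exprn_gt0// mul1r -[leLHS](sqr_sqrtr (ltW lk0)).
      by rewrite lerXn2r// ?nnegrE ?sqrtr_ge0 ?ltW.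
    have ejl : eps * j%:R <= eps * Num.sqrt (lam k) by rewrite ler_pM2l.
    rewrite [- lam k * _]mulNr; move: (lam k * _) => q; rewrite -[j.+1%:R]natr1; lra.
  rewrite lerDl; apply: mulr_ge0; first exact: expR_ge0.
  by apply: sumr_ge0 => i _; apply: mulr_ge0; [exact: expR_ge0|exact: sqr_ge0].
have q1 : expR (- eps) < 1 by rewrite expR_lt1; lra.
apply: (@le_trans _ _ (\sum_(k < n) (expR (2 * eps + 2) * \sum_(j < N)
    expR (- 2 * eps * j.+1%:R) * expR (- lam k * (j.+1%:R ^- 2)) ^+ 2) * phi k x ^+ 2)).
  by apply: ler_sum => k _; rewrite ler_wpM2r// sqr_ge0.
under eq_bigr do rewrite -mulrA mulr_suml.
rewrite -mulr_sumr /bergman_const ler_pM2l ?expR_gt0// exchange_big /=.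
apply: (@le_trans _ _ (\sum_(j < N) expR (- 2 * eps * j.+1%:R) *
    (heat_smoothing_const d L ^+ 2 * expR (2 * d%:R * ln (j.+1%:R : R))))).
  apply: ler_sum => j _.
  have j0 : 0 < j.+1%:R :> R by rewrite ltr0n.
  have t0 : 0 < (j.+1%:R ^- 2 : R) by rewrite invr_gt0 exprn_gt0.
  have := heat_kernel_diagonal R d Omega L lam phi n _ x oO L0 OL deb t0 Ox.
  rewrite lnV ?posrE ?exprn_gt0// lnXn// => H.
  under eq_bigr do rewrite -mulrA.
  rewrite -mulr_sumr ler_pM2l ?expR_gt0//.
  under eq_bigr do rewrite -exprMn.
  apply: le_trans H _; rewrite le_eqVlt; apply/orP; left; apply/eqP.
  by congr (_ * expR _); rewrite -mulr_natl; ring.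
have K2 : 0 <= heat_smoothing_const d L ^+ 2 by exact: sqr_ge0.
under eq_bigr do rewrite mulrCA.
rewrite -mulr_sumr ler_wpM2l//.
set C := expR (- 2 * d%:R * _).
apply: (@le_trans _ _ (\sum_(j < N) C * expR (- eps) ^+ j)).
  apply: ler_sum => j _.
  have := polynomial_le_exp R d j.+1 eps e0 (ltn0Sn _); rewrite -/C => H.
  rewrite mulrC; apply: le_trans (ler_wpM2r (expR_ge0 _) H) _.
  rewrite mulrAC [C * _]mulrC ler_pM2r ?expR_gt0// -expRD -expRM_natl ler_expR.
  rewrite -[j.+1%:R]natr1; nra.
rewrite -mulr_sumr ler_pM2l ?expR_gt0// -[leRHS]mul1r ler_pdivlMr ?subr_gt0//.
have := subrX1 (expR (- eps)) N; rewrite -opprB -[expR (- eps) - 1]opprB mulNr => /oppr_inj.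
by rewrite mulrC => <-; rewrite lerBlDr lerDl exprn_ge0// expR_ge0.
Qed.

(** * Duhamel's formula as a series *)

(** Lebesgue measure, to be seen as a measure on R with its default display: a
    raw set function carries integrability there, while the integrals
    live on measurableTypeR R. *)
Definition lebesgue_default {R : realType} : set R -> \bar R := lebesgue_measure.

Section lebesgue_default_measure.
Context {R : realType}.

Let lebesgue_default0 : @lebesgue_default R set0 = 0%E.
Proof. exact: measure0. Qed.

Let lebesgue_default_ge0 (A : set R) : (0 <= lebesgue_default A)%E.
Proof. exact: (@measure_ge0 _ (measurableTypeR R) R lebesgue_measure). Qed.

Let lebesgue_default_sigma : semi_sigma_additive (@lebesgue_default R).
Proof.
exact: (@measure_semi_sigma_additive _ (measurableTypeR R) R lebesgue_measure).
Qed.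

HB.instance Definition _ := isMeasure.Build _ R R (@lebesgue_default R)
  lebesgue_default0 lebesgue_default_ge0 lebesgue_default_sigma.

End lebesgue_default_measure.

(** The two measurable structures on R have the same measurable sets; the
    identity between them transports the integral as a pushforward. *)
Lemma integrable_default_display (R : realType) (D : set R) (f : R -> \bar R) :
  measurable D -> (lebesgue_measure : set R -> \bar R).-integrable D f ->
  @integrable _ (measurableTypeR R) R lebesgue_measure D f.
Proof.
move=> mD /integrableP[mf fy]; apply/integrableP; split; first exact: mf.
have mid : @measurable_fun _ _ R (measurableTypeR R) setT id by move=> _ A mA; rewrite setTI.
have mfa : @measurable_fun _ _ (measurableTypeR R) (\bar R) D (abse \o f).
  by apply: measurableT_comp => //; exact: mf.
have := @ge0_integral_pushforward _ _ R (measurableTypeR R) R id mid lebesgue_default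
  D (abse \o f) mD mfa (fun _ _ => abse_ge0 _).
by move=> E; apply: le_lt_trans fy; rewrite le_eqVlt; apply/orP; left; apply/eqP; exact: E.
Qed.

Lemma gevrey_partial (R : realType) (d : nat) (Omega : set 'rV[R]_d)
    (lam : nat -> R) (phi : nat -> 'rV[R]_d -> R) (rho M : R) (f : 'rV[R]_d -> R) n :
  gevrey Omega lam phi rho f -> gevrey_norm Omega lam phi rho f <= M ->
  \sum_(k < n) expR (2 * rho * Num.sqrt (lam k)) * L2inner Omega f (phi k) ^+ 2 <= M ^+ 2.
Proof.
move=> [_ Efin] EM.
have E0 : (0 <= gevrey_energy Omega lam phi rho f)%E.
  by apply: nneseries_ge0 => k _ _; rewrite lee_fin mulr_ge0 ?expR_ge0 ?sqr_ge0.
have M0 : 0 <= M by apply: le_trans EM; exact: sqrtr_ge0.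
have le_n : ((\sum_(k < n) expR (2 * rho * Num.sqrt (lam k)) * L2inner Omega f (phi k) ^+ 2)%:E
    <= gevrey_energy Omega lam phi rho f)%E.
  rewrite -sumEFin; apply: le_trans (nneseries_lim_ge n _); last first.
    by move=> k _ _; rewrite lee_fin mulr_ge0 ?expR_ge0 ?sqr_ge0.
  rewrite big_mkord le_eqVlt; apply/orP; left; apply/eqP; apply: eq_bigr => k _.
  by rewrite real_normK ?num_real.
have Efn : gevrey_energy Omega lam phi rho f \is a fin_num by rewrite ge0_fin_numE.
rewrite -(fineK Efn) lee_fin in le_n; apply: le_trans le_n _.
have f0 : 0 <= fine (gevrey_energy Omega lam phi rho f) by rewrite fine_ge0.
by rewrite -[leLHS]sqr_sqrtr// lerXn2r// nnegrE sqrtr_ge0.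
Qed.

Lemma absolute_series_cvg (R : realType) (c : nat -> R) (K : R) :
  (forall n, \sum_(k < n) `|c k| <= K) -> cvgn (fun n => \sum_(k < n) c k).
Proof.
move=> cK.
have -> : (fun n => \sum_(k < n) c k) = series c.
  by apply/funext => n; rewrite /series/= big_mkord.
apply: (@normed_cvg R R^o); apply: nondecreasing_is_cvgn.
  by apply: nondecreasing_series => k _ _; exact: normr_ge0.
by exists K => _ [n _ <-]; have := cK n; rewrite -(big_mkord xpredT (fun k => `|c k|)).
Qed.

Section duhamel_series.
Context {R : realType}.
Variables (lam c : nat -> R) (K T : R) (g : R -> R).
Hypothesis lam_gt0 : forall k, 0 < lam k.
Hypothesis cK : forall n, \sum_(k < n) `|c k| <= K.
Hypothesis ig : @integrable _ (measurableTypeR R) R lebesgue_measure `]0, T[ (EFin \o g).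

Let D : set (measurableTypeR R) := `]0, T[%classic.
Let mD : measurable D. Proof. exact: measurable_itv. Qed.
Let heat k s := expR (- lam k * (T - s)).

Let heat01 k s : D s -> 0 <= heat k s <= 1.
Proof.
rewrite /D/= in_itv/= => /andP[_ sT]; rewrite expR_ge0 expR_le1/=.
by rewrite mulNr oppr_le0 mulr_ge0 ?(ltW (lam_gt0 k))//; lra.
Qed.

Let mg : measurable_fun D g.
Proof. by apply/measurable_EFinP; exact: measurable_int ig. Qed.

Let mheat k : measurable_fun D (heat k).
Proof.
apply: measurable_funTS; apply: continuous_measurable_fun => s.
apply: (@continuous_comp _ _ _ (fun s => - lam k * (T - s)) expR); last exact: continuous_expR.
by apply: cvgMr; apply: cvgB; [exact: cvg_cst|exact: cvg_id].
Qed.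

Lemma integrable_source_heat k :
  @integrable _ (measurableTypeR R) R lebesgue_measure D (EFin \o (fun s => g s * heat k s)).
Proof.
apply: (@le_integrable _ _ R lebesgue_measure D mD _ (EFin \o g)) => //.
  by apply/measurable_EFinP; exact: measurable_funM.
move=> s Ds; rewrite /= lee_fin normrM; have /andP[h0 h1] := heat01 k s Ds.
by rewrite ler_piMr// ger0_norm.
Qed.

Lemma source_coefficient_le k :
  `|(\int[lebesgue_measure]_(s in `]0%R, T[) (g s * expR (- lam k * (T - s))))%R| <=
   (\int[lebesgue_measure]_(s in `]0%R, T[) `|g s|)%R.
Proof.
apply: le_trans (le_normr_Rintegral _ (integrable_source_heat k)) _ => //.
apply: le_Rintegral => //.
- by have := integrable_abse (integrable_source_heat k).
- by have := integrable_abse ig.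
move=> s Ds; rewrite normrM; have /andP[h0 h1] := heat01 k s Ds.
by rewrite ler_piMr// ger0_norm.
Qed.

(** Dominated convergence: the heat factors lie in [0, 1], so K |g| dominates
    all partial sums. *)
Lemma duhamel_series_cvg :
  (fun n => \sum_(k < n) c k *
     (\int[lebesgue_measure]_(s in `]0%R, T[) (g s * expR (- lam k * (T - s))))%R) @ \oo -->
  (\int[lebesgue_measure]_(s in `]0%R, T[)
     (g s * limn (fun n => \sum_(k < n) expR (- lam k * (T - s)) * c k)))%R.
Proof.
pose S n s := \sum_(k < n) heat k s * c k.
have SK n s : D s -> `|S n s| <= K.
  move=> Ds; apply: le_trans (ler_norm_sum _ _ _) _; apply: le_trans (cK n).
  apply: ler_sum => k _; rewrite normrM; have /andP[h0 h1] := heat01 k s Ds.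
  by rewrite ger0_norm// ler_piMl.
have Scvg s : D s -> (fun n => S n s) @ \oo --> limn (S ^~ s).
  move=> Ds; apply: (@absolute_series_cvg _ (fun k => heat k s * c k) K) => n.
  apply: le_trans (cK n); apply: ler_sum => k _; rewrite normrM.
  by have /andP[h0 h1] := heat01 k s Ds; rewrite ger0_norm// ler_piMl.
have mS n : measurable_fun D (S n).
  by apply: measurable_sum => k; apply: measurable_funM => //; exact: measurable_cst.
pose F n s := g s * S n s.
pose Finf s := g s * limn (S ^~ s).
have mF n : measurable_fun D (EFin \o F n).
  by apply/measurable_EFinP; exact: measurable_funM.
have Fcvg s : D s -> (EFin \o F n) s @[n --> \oo] --> (EFin \o Finf) s.
  move=> Ds; apply: cvg_EFin; first by near=> n.
  by apply: cvgMr; exact: Scvg.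
have mFinf : measurable_fun D (EFin \o Finf).
  exact: (emeasurable_fun_cvg (fun n => EFin \o F n)).
have iK : @integrable _ (measurableTypeR R) R lebesgue_measure D
    (fun s => K%:E * (abse ((EFin \o g) s)))%E.
  by apply: integrableZl => //; exact: integrable_abse.
have [] := @dominated_convergence _ _ R lebesgue_measure D mD (fun n => EFin \o F n)
  (EFin \o Finf) _ mF mFinf (aeW _ Fcvg) iK _.
  apply: aeW => s n Ds; rewrite /= lee_fin normrM mulrC ler_wpM2r//.
  exact: SK.
move=> iFinf _ cvgF.
have fin : (\int[lebesgue_measure]_(s in D) (EFin \o Finf) s)%E \is a fin_num.
  exact: integrable_fin_num.
rewrite -(fineK fin) in cvgF.
have := fine_cvg cvgF.
have -> : fine \o (fun n => \int[lebesgue_measure]_(s in D) (EFin \o F n) s)%E =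
   (fun n => \sum_(k < n) c k *
     (\int[lebesgue_measure]_(s in `]0%R, T[) (g s * expR (- lam k * (T - s))))%R).
  apply/funext => n /=; rewrite -[LHS]/(\int[lebesgue_measure]_(s in D) F n s)%R.
  elim: n => [|n IH].
    rewrite big_ord0; transitivity (\int[lebesgue_measure]_(s in D) (0 : R))%R.
      by apply: eq_Rintegral => s _; rewrite /F /S big_ord0 mulr0.
    by rewrite Rintegral_cst// mul0r.
  rewrite big_ord_recr/= -IH -RintegralZl//; last exact: integrable_source_heat.
  rewrite -RintegralD//.
  - by apply: eq_Rintegral => s _; rewrite /F /S big_ord_recr/= /heat; ring.
  - apply: (@le_integrable _ _ R lebesgue_measure D mD _ _ _ _ iK); first exact: mF.
    move=> s Ds; rewrite /= lee_fin !normrM normr_id mulrC ler_wpM2r//.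
    by apply: le_trans (SK n s Ds) _; exact: ler_norm.
  - have := integrableZl mD (c n) (integrable_source_heat n).
    by apply: eq_integrable => // s _; rewrite /= EFinM.
by apply.
Unshelve. all: by end_near. Qed.

End duhamel_series.

(** * Frequency cut-off and interpolation *)

(** Only one half of Parseval's identity; it follows from completeness and the
    triangle inequality. *)
Lemma L2norm_le_coefficients (R : realType) (d : nat) (Omega : set 'rV[R]_d)
    (lam : nat -> R) (phi : nat -> 'rV[R]_d -> R) (f : 'rV[R]_d -> R) (Q : R) :
  dirichlet_eigenbasis Omega lam phi -> L2 Omega f -> 0 <= Q ->
  (forall n, \sum_(k < n) L2inner Omega f (phi k) ^+ 2 <= Q ^+ 2) ->
  L2norm Omega f <= Q.
Proof.
move=> deb Lf Q0 fQ.
pose S n x := \sum_(k < n) L2inner Omega f (phi k) * phi k x.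
have LS n : L2 Omega (S n)
  by exact: (L2_sum Omega n (fun k => L2inner Omega f (phi k)) phi (deb_L2 deb)).
have SQ n : L2norm Omega (S n) <= Q.
  rewrite -(ler_pXn2r (ltn0Sn 1)) ?nnegrE ?L2norm_ge0//.
  rewrite (L2norm_sum_sqr Omega n (fun k => L2inner Omega f (phi k)) phi
    (deb_L2 deb) (deb_orthonormal deb)).
  exact: fQ.
have cv : (fun n => L2norm Omega (fun x => f x - S n x) + Q) @ \oo --> 0 + Q.
  by apply: cvgD; [exact: deb_complete deb f Lf|exact: cvg_cst].
rewrite add0r in cv; rewrite -(cvg_lim _ cv)//.
apply: limr_ge; first exact: (cvgP _ cv).
near=> n; apply: le_trans (L2norm_triangle _ _ _ Lf (LS n)) _.
by rewrite lerD2l.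
Unshelve. all: by end_near. Qed.

(** On lam_k > Lam, the weight exp(-rho sqrt lam_k) is at most
    exp(-(rho - eps) sqrt Lam) exp(-eps sqrt lam_k). The remaining products are
    split by Young's inequality with parameter 1 / M, so that the Gevrey bound M^2
    and the bound for the eigenfunctions both contribute linearly in M. *)
Lemma weighted_tail (R : realType) (d : nat) (Omega : set 'rV[R]_d) (L eps rho M Lam : R)
    (lam : nat -> R) (phi : nat -> 'rV[R]_d -> R) (f : 'rV[R]_d -> R) (n : nat) (x : 'rV[R]_d) :
  open Omega -> 0 < L -> (forall y i, Omega y -> `|y ord0 i| < L) ->
  dirichlet_eigenbasis Omega lam phi -> 0 < eps -> eps <= rho -> 0 < M -> 0 <= Lam ->
  gevrey Omega lam phi rho f -> gevrey_norm Omega lam phi rho f <= M -> Omega x ->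
  \sum_(k < n | Lam < lam k) `|L2inner Omega f (phi k) * phi k x| <=
    M * (1 + bergman_const d L eps) / 2 * expR (- (rho - eps) * Num.sqrt Lam).
Proof.
move=> oO L0 OL deb e0 er M0 Lam0 Gf GM Ox.
set B := bergman_const d L eps.
have gev := gevrey_partial R d Omega lam phi rho M f n Gf GM.
have ber := bergman_bound R d Omega L eps lam phi n x oO L0 OL deb e0 Ox.
set E := expR (- (rho - eps) * Num.sqrt Lam).
pose F k := L2inner Omega f (phi k).
apply: (@le_trans _ _ (\sum_(k < n) E *
   ((M^-1 * (expR (2 * rho * Num.sqrt (lam k)) * F k ^+ 2) +
     M * (expR (- 2 * eps * Num.sqrt (lam k)) * phi k x ^+ 2)) / 2))).
  rewrite [leLHS]big_mkcond; apply: ler_sum => k _.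
  set a := expR (rho * Num.sqrt (lam k)) * `|F k|.
  set b := expR (- eps * Num.sqrt (lam k)) * `|phi k x|.
  have a2 : expR (2 * rho * Num.sqrt (lam k)) * F k ^+ 2 = a ^+ 2.
    by rewrite /a exprMn -expRM_natl real_normK ?num_real// mulrA.
  have b2 : expR (- 2 * eps * Num.sqrt (lam k)) * phi k x ^+ 2 = b ^+ 2.
    by rewrite /b exprMn -expRM_natl real_normK ?num_real//; congr (expR _ * _); ring.
  rewrite a2 b2.
  have ab : a * b <= (M^-1 * a ^+ 2 + M * b ^+ 2) / 2.
    have : 0 <= M^-1 * (a - M * b) ^+ 2 by rewrite mulr_ge0 ?sqr_ge0// invr_ge0 ltW.
    have -> : M^-1 * (a - M * b) ^+ 2 = M^-1 * a ^+ 2 - 2 * (a * b) + M * b ^+ 2.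
      by field; rewrite gt_eqF.
    lra.
  case: ifPn => [lk|_]; last first.
    by rewrite mulr_ge0 ?expR_ge0// divr_ge0// addr_ge0// mulr_ge0 ?sqr_ge0// ?invr_ge0 ltW.
  apply: le_trans (ler_wpM2l (expR_ge0 _) ab).
  have -> : E * (a * b) =
     expR (- (rho - eps) * Num.sqrt Lam + (rho - eps) * Num.sqrt (lam k)) *
     (`|F k| * `|phi k x|).
    have -> : expR (- (rho - eps) * Num.sqrt Lam + (rho - eps) * Num.sqrt (lam k)) =
        E * expR (rho * Num.sqrt (lam k)) * expR (- eps * Num.sqrt (lam k)).
      by rewrite /E -!expRD; congr expR; ring.
    by rewrite /a /b; ring.
  rewrite normrM -[leLHS]mul1r ler_wpM2r ?mulr_ge0// -[leLHS]expR0 ler_expR.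
  have : (rho - eps) * Num.sqrt Lam <= (rho - eps) * Num.sqrt (lam k).
    by rewrite ler_wpM2l ?subr_ge0// ler_wsqrtr// ltW.
  rewrite mulNr; lra.
rewrite -mulr_sumr mulrC ler_wpM2r ?expR_ge0// -mulr_suml ler_pM2r ?invr_gt0//.
rewrite big_split/= -!mulr_sumr mulrDr mulr1 lerD//.
  by rewrite ler_pdivrMl//; apply: le_trans gev _; rewrite expr2.
by rewrite ler_pM2l.
Qed.

(** For 0 < U < M both terms agree when r = ln (M / U) / (p + q); for U >= M the
    bound N <= M suffices, and for U = 0 letting r grow forces N = 0. *)
Lemma interpolation_optimization (R : realType) (N C0 M U p q : R) :
  0 < p -> 0 < q -> 1 <= C0 -> 0 < M -> 0 <= U -> 0 <= N -> N <= M ->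
  (forall r, 0 < r -> N <= C0 * (expR (p * r) * U + M * expR (- q * r))) ->
  N <= 2 * C0 * M `^ (1 - q / (p + q)) * U `^ (q / (p + q)).
Proof.
move=> p0 q0 C1 M0 U0 N0 NM H; set alpha := q / (p + q).
have pq0 : 0 < p + q by lra.
have a0 : 0 < alpha by rewrite divr_gt0.
have C0' : 0 < C0 by lra.
have [UE|Un0] := eqVneq U 0.
  rewrite UE powR0 ?gt_eqF// mulr0 leNgt; apply/negP => N_gt0.
  (* r is chosen such that exp(- q r) = z, which yields N <= N / 2 *)
  pose z := N / (2 * C0 * M).
  have z0 : 0 < z by rewrite divr_gt0// !mulr_gt0.
  have z1 : z < 1.
    by rewrite ltr_pdivrMr ?mulr_gt0// mul1r; nra.
  have r0 : 0 < - ln z / q by rewrite divr_gt0// oppr_gt0 ln_lt0// z0.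
  have := H _ r0; rewrite UE mulr0 add0r.
  have -> : - q * (- ln z / q) = ln z by field; rewrite gt_eqF.
  rewrite lnK ?posrE// /z.
  have -> : C0 * (M * (N / (2 * C0 * M))) = N / 2 by field; rewrite !gt_eqF.
  lra.
have U_gt0 : 0 < U by rewrite lt_neqAle eq_sym Un0.
have ME : M = M `^ (1 - alpha) * M `^ alpha.
  by rewrite -powRD ?subrK ?powRr1 ?(ltW M0)// gt_eqF ?implybT.
have [UM|MU] := ltP U M; last first.
  apply: le_trans NM _; rewrite [leLHS]ME -mulrA.
  apply: (@le_trans _ _ (1 * (M `^ (1 - alpha) * U `^ alpha))).
    by rewrite mul1r ler_wpM2l ?powR_ge0// ge0_ler_powR// ?nnegrE ltW.
  by rewrite ler_wpM2r ?mulr_ge0 ?powR_ge0//; lra.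
pose r := (ln M - ln U) / (p + q).
have r0 : 0 < r by rewrite divr_gt0// subr_gt0 ltr_ln ?posrE.
have := H r r0.
have E1 : expR (p * r) * U = M `^ (1 - alpha) * U `^ alpha.
  rewrite /powR !gt_eqF// -[X in _ * X = _](lnK (_ : U \in Num.pos)) ?posrE//.
  rewrite -!expRD; congr expR; rewrite /r /alpha; field; rewrite gt_eqF//.
have E2 : M * expR (- q * r) = M `^ (1 - alpha) * U `^ alpha.
  rewrite /powR !gt_eqF// -[X in X * _ = _](lnK (_ : M \in Num.pos)) ?posrE//.
  rewrite -!expRD; congr expR; rewrite /r /alpha; field; rewrite gt_eqF//.
by rewrite E1 E2 => /le_trans; apply; rewrite le_eqVlt; apply/orP; left; apply/eqP; ring.
Qed.

Lemma eigenvalue_cutoff (R : realType) (lam : nat -> R) (Lam : R) :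
  nondecreasing_seq lam -> lam @ \oo --> +oo ->
  exists N : nat, forall k, (lam k <= Lam) = (k < N)%N.
Proof.
move=> ndlam lamoo.
have ex : exists n, Lam < lam n.
  have [n _ Hn] : \forall n \near \oo, Lam < lam n by move/cvgryPgt : lamoo; exact.
  by exists n; apply: Hn => /=.
have [N LN minN] := ex_minnP ex; exists N => k; apply/idP/idP => [kL|kN].
  rewrite ltnNge; apply/negP => /ndlam Nk.
  by have := lt_le_trans LN Nk; rewrite ltNge kL.
by rewrite leNgt; apply/negP => /minN; rewrite leqNgt kN.
Qed.

Definition source_coefficient {R : realType} (g : R -> R) (T lambda : R) : R :=
  (\int[lebesgue_measure]_(s in `]0%R, T[) (g s * expR (- lambda * (T - s))))%R.

Section observation.
Context {R : realType} {d : nat}.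
Variables (Omega omega : set 'rV[R]_d) (lam : nat -> R) (phi : nat -> 'rV[R]_d -> R).
Variables (C_S rho eps c_g L T M : R) (f : 'rV[R]_d -> R) (g : R -> R).
Hypotheses (oO : open Omega) (L0 : 0 < L)
  (OL : forall y i, Omega y -> `|y ord0 i| < L)
  (deb : dirichlet_eigenbasis Omega lam phi) (wO : omega `<=` Omega).
Hypotheses (CS0 : 0 < C_S) (e0 : 0 < eps) (er : eps <= rho) (M0 : 0 < M) (cg0 : 0 < c_g).
Hypothesis spec : forall (Lambda : R) (v : 'rV[R]_d -> R), 0 < Lambda -> L2 Omega v ->
  ((L2norm Omega (spectral_proj Omega lam phi Lambda v))%:E <=
   (C_S * expR (C_S * Num.sqrt Lambda))%:E *
     sup_abs omega (spectral_proj Omega lam phi Lambda v))%E.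
Hypotheses (Gf : gevrey Omega lam phi rho f) (GM : gevrey_norm Omega lam phi rho f <= M).
Hypothesis ig : (lebesgue_measure : set R -> \bar R).-integrable `]0, T[ (EFin \o g).
Hypothesis ag : forall k, c_g / lam k <= `|source_coefficient g T (lam k)|.

Let F k := L2inner Omega f (phi k).
Let a k := source_coefficient g T (lam k).
Let normg := (\int[lebesgue_measure]_(s in `]0%R, T[) `|g s|)%R.
Let K := M * (1 + bergman_const d L eps) / 2.

Let ig' : @integrable _ (measurableTypeR R) R lebesgue_measure `]0, T[ (EFin \o g).
Proof. by apply: integrable_default_display => //; exact: measurable_itv. Qed.

Let lam_gt0 k : 0 < lam k. Proof. exact: deb_pos deb k. Qed.

Lemma source_coefficient_bound k : `|a k| <= normg.
Proof. exact: source_coefficient_le. Qed.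

Lemma normg_ge0 : 0 <= normg.
Proof. exact: le_trans (source_coefficient_bound 0%N). Qed.

Let tail n x Lam : Omega x -> 0 <= Lam ->
  \sum_(k < n | Lam < lam k) `|F k * phi k x| <=
    K * expR (- (rho - eps) * Num.sqrt Lam).
Proof. by move=> Ox Lam0; exact: weighted_tail. Qed.

Lemma duhamel_expansion x : Omega x ->
  (fun n => \sum_(k < n) F k * phi k x * a k) @ \oo --> duhamel Omega lam phi g f T x.
Proof.
move=> Ox.
have cK n : \sum_(k < n) `|F k * phi k x| <= K.
  have := tail n x 0 Ox (lexx _); rewrite sqrtr0 mulr0 expR0 mulr1.
  by rewrite (eq_bigl xpredT) => // k; rewrite lam_gt0.
have := duhamel_series_cvg lam (fun k => F k * phi k x) K T g lam_gt0 cK ig'.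
congr (_ --> _); rewrite /duhamel; apply: eq_Rintegral => s _.
rewrite /heat_semigroup; congr (_ * _).
have -> // : (fun n => \sum_(k < n) expR (- lam k * (T - s)) * (F k * phi k x)) =
   (fun n => \sum_(k < n) expR (- lam k * (T - s)) * F k * phi k x).
by apply/funext => n; apply: eq_bigr => k _; rewrite mulrA.
Qed.

(** The sum differs from u(x,T) by its tail only, and the tail is controlled at
    every finite stage of the series. *)
Lemma low_frequency_le N Lam x U : Omega x -> 0 <= Lam ->
  (forall k, (lam k <= Lam) = (k < N)%N) ->
  `|duhamel Omega lam phi g f T x| <= U ->
  `|\sum_(k < N) a k * F k * phi k x| <=
    U + normg * (K * expR (- (rho - eps) * Num.sqrt Lam)).
Proof.
move=> Ox Lam0 cutN uU.
set Z := normg * _.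
have cv : (fun n => `|\sum_(k < n) F k * phi k x * a k| + Z) @ \oo -->
    `|duhamel Omega lam phi g f T x| + Z.
  apply: cvgD; last exact: cvg_cst.
  by apply: cvg_norm; exact: duhamel_expansion.
apply: le_trans (_ : `|duhamel Omega lam phi g f T x| + Z <= _); last by rewrite lerD2r.
rewrite -(cvg_lim _ cv)//; apply: limr_ge; first exact: (cvgP _ cv).
near=> n.
have Nn : (N <= n)%N by near: n; exact: nbhs_infty_ge.
pose G (k : nat) := F k * phi k x * a k.
have -> : \sum_(k < N) a k * F k * phi k x = \sum_(k < n | ~~ (Lam < lam k)) G k.
  rewrite (big_ord_widen n (fun k => a k * F k * phi k x) Nn).
  by apply: eq_big => k; [rewrite -leNgt cutN|rewrite /G => _; ring].
have -> : \sum_(k < n) F k * phi k x * a k =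
    \sum_(k < n | Lam < lam k) G k + \sum_(k < n | ~~ (Lam < lam k)) G k.
  by rewrite (bigID (fun k : 'I_n => Lam < lam k)).
set A := \sum_(k < n | Lam < _) _; set B := \sum_(k < n | ~~ _) _.
have AZ : `|A| <= Z.
  apply: le_trans (ler_norm_sum _ _ _) _; rewrite /Z.
  apply: le_trans (ler_wpM2l normg_ge0 (tail n x Lam Ox Lam0)).
  rewrite mulr_sumr; apply: ler_sum => k _; rewrite /G normrM mulrC.
  by rewrite ler_wpM2r// source_coefficient_bound.
have := ler_normB (A + B) A; rewrite addrAC subrr add0r; lra.
Unshelve. all: by end_near. Qed.

(** The projected function is v = sum_(k < N) a_k f_k phi_k, which is u(.,T)
    without its tail, so that the spectral inequality can be used on v although
    u(.,T) itself is only known pointwise. *)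
Lemma cutoff_estimate Lam U : 0 < Lam -> omega !=set0 ->
  (forall x, omega x -> `|duhamel Omega lam phi g f T x| <= U) ->
  L2norm Omega f <=
    Lam / c_g * (C_S * expR (C_S * Num.sqrt Lam) *
      (U + normg * (K * expR (- (rho - eps) * Num.sqrt Lam)))) +
    M * expR (- rho * Num.sqrt Lam).
Proof.
move=> Lam0 w0 uU.
have [N cutN] := eigenvalue_cutoff _ lam Lam (deb_nondecreasing deb) (deb_cvg deb).
set W := U + _.
pose v x := \sum_(k < N) a k * F k * phi k x.
have Lv : L2 Omega v by exact: (L2_sum Omega N (fun k => a k * F k) phi (deb_L2 deb)).
have PE : spectral_proj Omega lam phi Lam v = v.
  apply/funext => x; rewrite /spectral_proj.
  have -> : [set k | lam k <= Lam] = `I_N by apply/seteqP; split => k /=; rewrite cutN.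
  rewrite -fsbig_ord; apply: eq_bigr => j _; congr (_ * _).
  rewrite (L2inner_suml Omega N (fun k => a k * F k) phi (phi j) (deb_L2 deb) (deb_L2 deb j)).
  rewrite (bigD1 j)//= (deb_orthonormal deb) eqxx mulr1 big1 ?addr0// => k kj.
  rewrite (deb_orthonormal deb); have -> : (k == j :> nat) = false by apply/negbTE.
  by rewrite mulr0.
have supW : (sup_abs omega v <= W%:E)%E.
  apply: ge_ereal_sup => _ [x wx <-]; rewrite lee_fin.
  exact: low_frequency_le (wO _ wx) (ltW Lam0) cutN (uU x wx).
have vW : L2norm Omega v <= C_S * expR (C_S * Num.sqrt Lam) * W.
  rewrite -lee_fin EFinM; have := spec Lam v Lam0 Lv; rewrite PE => /le_trans; apply.
  by rewrite lee_wpmul2l// lee_fin mulr_ge0 ?expR_ge0// ltW.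
set X := Lam / c_g * _; set Y := M * _.
have Lc0 : 0 < Lam / c_g by rewrite divr_gt0.
have vX : Lam / c_g * L2norm Omega v <= X by rewrite ler_pM2l.
have X0 : 0 <= X by apply: le_trans vX; rewrite mulr_ge0 ?L2norm_ge0// ltW.
have Y0 : 0 <= Y by rewrite mulr_ge0 ?expR_ge0// ltW.
apply: (L2norm_le_coefficients R d Omega lam phi f (X + Y) deb (proj1 Gf)).
  by rewrite addr_ge0.
move=> n; rewrite (bigID (fun k : 'I_n => lam k <= Lam))/=.
have low : \sum_(k < n | lam k <= Lam) F k ^+ 2 <= X ^+ 2.
  apply: (@le_trans _ _ (\sum_(k < N) F k ^+ 2)).
    rewrite (eq_bigl (fun k : 'I_n => (k < N)%N)); last by move=> k; rewrite cutN.
    have [nN|Nn] := leqP n N.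
      rewrite (big_ord_widen_cond N (fun k => (k < N)%N) (fun k => F k ^+ 2) nN).
      rewrite [leLHS]big_mkcond; apply: ler_sum => k _.
      by case: ifPn => // _; exact: sqr_ge0.
    by rewrite (big_ord_widen n (fun k => F k ^+ 2) (ltnW Nn)).
  apply: (@le_trans _ _ ((Lam / c_g * L2norm Omega v) ^+ 2)); last first.
    by rewrite lerXn2r ?nnegrE// mulr_ge0 ?L2norm_ge0// ltW.
  rewrite exprMn (L2norm_sum_sqr Omega N (fun k => a k * F k) phi (deb_L2 deb)
    (deb_orthonormal deb)).
  rewrite mulr_sumr; apply: ler_sum => k _.
  rewrite -exprMn -[leLHS]real_normK ?num_real// -[leRHS]real_normK ?num_real//.
  rewrite lerXn2r// ?nnegrE// mulrA normrM ler_peMl//.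
  have lkL : lam k <= Lam by rewrite cutN.
  rewrite normrM (gtr0_norm Lc0) mulrAC ler_pdivlMr// mul1r.
  have := ag k; rewrite ler_pdivrMr// -/(a k) => H; apply: le_trans H _.
  by rewrite mulrC ler_wpM2r.
have high : \sum_(k < n | ~~ (lam k <= Lam)) F k ^+ 2 <= Y ^+ 2.
  have gev := gevrey_partial R d Omega lam phi rho M f n Gf GM.
  apply: (@le_trans _ _ (expR (- (2 * rho * Num.sqrt Lam)) * M ^+ 2)); last first.
    rewrite /Y exprMn mulrC -expRM_natl; apply: ler_wpM2l; first exact: sqr_ge0.
    by rewrite ler_expR; lra.
  apply: le_trans (ler_wpM2l (expR_ge0 _) gev).
  rewrite mulr_sumr [leLHS]big_mkcond; apply: ler_sum => k _.
  case: ifPn => [lk|_]; last first.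
    by apply: mulr_ge0; last (apply: mulr_ge0; last exact: sqr_ge0); exact: expR_ge0.
  rewrite mulrA -expRD -[leLHS]mul1r ler_wpM2r ?sqr_ge0// -[leLHS]expR0 ler_expR.
  have : rho * Num.sqrt Lam <= rho * Num.sqrt (lam k).
    rewrite ler_wpM2l ?(le_trans (ltW e0) er)// ler_wsqrtr//.
    by move: lk; rewrite -ltNge => /ltW.
  lra.
have -> : (X + Y) ^+ 2 = X ^+ 2 + Y ^+ 2 + 2 * (X * Y) by ring.
have XY0 : 0 <= X * Y by rewrite mulr_ge0.
lra.
Qed.

End observation.

Lemma bounded_coordinates (R : realType) (d : nat) (Omega : set 'rV[R]_d) :
  bounded_set Omega ->
  exists2 L : R, 0 < L & forall y i, Omega y -> `|y ord0 i| < L.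
Proof.
move=> [B [_ HB]]; exists (`|B| + 2); first by rewrite ltr_wpDl.
move=> y i Oy.
have yB : `|y| <= `|B| + 1 by apply: HB => //; have := ler_norm B; lra.
suff : `|y ord0 i| <= `|y| by lra.
have /mapP[j Hj ->] : `|y ord0 i| \in [seq `|y x.1 x.2| | x : 'I_1 * 'I_d].
  by apply/mapP; exists (ord0, i) => //=; rewrite mem_enum.
by rewrite [leRHS]/Num.Def.normr /= mx_normrE; apply/bigmax_geP; right => /=; exists j.
Qed.

Lemma sqr_le_expR (R : realType) (e r : R) : 0 < e -> 0 <= r ->
  r ^+ 2 <= 2 / e ^+ 2 * expR (e * r).
Proof.
move=> e0 r0; have er0 : 0 <= e * r by rewrite mulr_ge0// ltW.
have := expR_ge1Dxn 1 er0; rewrite -[2`!]/2%N => H.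
have e2 : 0 < e ^+ 2 by rewrite exprn_gt0.
rewrite mulrAC ler_pdivlMr//.
have : (e * r) ^+ 2 / 2 <= expR (e * r) by lra.
by rewrite ler_pdivrMr// exprMn; lra.
Qed.

Lemma gevrey_L2norm_le (R : realType) (d : nat) (Omega : set 'rV[R]_d)
    (lam : nat -> R) (phi : nat -> 'rV[R]_d -> R) (rho M : R) (f : 'rV[R]_d -> R) :
  dirichlet_eigenbasis Omega lam phi -> 0 <= rho -> 0 <= M ->
  gevrey Omega lam phi rho f -> gevrey_norm Omega lam phi rho f <= M ->
  L2norm Omega f <= M.
Proof.
move=> deb rho0 M0 Gf GM.
apply: (L2norm_le_coefficients R d Omega lam phi f M deb (proj1 Gf) M0) => n.
apply: le_trans (gevrey_partial R d Omega lam phi rho M f n Gf GM).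
apply: ler_sum => k _; rewrite -[leLHS]mul1r ler_wpM2r ?sqr_ge0//.
by rewrite -[leLHS]expR0 ler_expR !mulr_ge0.
Qed.

(** The spectral inequality fails on the empty set even for v = 0, the supremum
    being -oo there. *)
Lemma observation_set_nonempty (R : realType) (d : nat) (Omega omega : set 'rV[R]_d)
    (lam : nat -> R) (phi : nat -> 'rV[R]_d -> R) (C_S : R) :
  0 < C_S ->
  (forall (Lambda : R) (v : 'rV[R]_d -> R), 0 < Lambda -> L2 Omega v ->
      ((L2norm Omega (spectral_proj Omega lam phi Lambda v))%:E <=
       (C_S * expR (C_S * Num.sqrt Lambda))%:E *
         sup_abs omega (spectral_proj Omega lam phi Lambda v))%E) ->
  omega !=set0.
Proof.
move=> CS0 spec; apply/set0P/eqP => w0.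
have := spec 1 _ ltr01 (L2_zero Omega).
rewrite /sup_abs w0 image_set0 ereal_sup0 gt0_muleNy ?leeNy_eq//.
by rewrite lte_fin mulr_gt0 ?expR_gt0.
Qed.

Theorem theorem1p8 (R : realType) (C_S rho : R)
    (C_S_gt0 : 0 < C_S) (rho_gt : C_S < rho) :
  exists alpha : R, 0 < alpha < 1 /\
  forall (d : nat) (Omega : set 'rV[R]_d),
    (0 < d)%N -> smooth_bounded_domain Omega ->
  forall c_g normg : R, 0 < c_g ->
  exists C : R, 0 < C /\
  forall (lam : nat -> R) (phi : nat -> 'rV[R]_d -> R),
    dirichlet_eigenbasis Omega lam phi ->
  forall (gamma : R) (omega : set 'rV[R]_d),
    0 < gamma -> omega `<=` Omega ->
    (0 < hausdorff_content (d%:R - 1 + gamma) omega)%E ->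
    (forall (Lambda : R) (v : 'rV[R]_d -> R), 0 < Lambda -> L2 Omega v ->
      ((L2norm Omega (spectral_proj Omega lam phi Lambda v))%:E <=
       (C_S * expR (C_S * Num.sqrt Lambda))%:E *
         sup_abs omega (spectral_proj Omega lam phi Lambda v))%E) ->
  forall (T M : R) (f : 'rV[R]_d -> R) (g : R -> R),
    0 < T ->
    gevrey Omega lam phi rho f ->
    gevrey_norm Omega lam phi rho f <= M ->
    (lebesgue_measure : set R -> \bar R).-integrable `]0, T[ (EFin \o g) ->
    normg = (\int[lebesgue_measure]_(s in `]0%R, T[) `|g s|)%R ->
    (forall k : nat,
      c_g / lam k <=
      `| (\int[lebesgue_measure]_(s in `]0%R, T[)
            (g s * expR (- lam k * (T - s))))%R |) ->
    ((L2norm Omega f)%:E <=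
     (C * M `^ (1 - alpha))%:E *
       (sup_abs omega (duhamel Omega lam phi g f T)) `^ alpha)%E.
Proof.
(* eps is spent twice: once to absorb the factor Lambda, once in the tail *)
pose eps := (rho - C_S) / 4; pose p := C_S + eps; pose q := (rho - C_S) / 2.
have e0 : 0 < eps by rewrite divr_gt0// subr_gt0.
have p0 : 0 < p by rewrite addr_gt0.
have q0 : 0 < q by rewrite divr_gt0// subr_gt0.
have pq0 : 0 < p + q by lra.
exists (q / (p + q)); split.
  by rewrite divr_gt0//= ltr_pdivrMr// mul1r ltrDr.
move=> d Omega _ [oO _ _ bO _] c_g normg cg0.
have [L L0 OL] := bounded_coordinates R d Omega bO.
pose A := 2 * C_S / (eps ^+ 2 * c_g).
pose B := (1 + bergman_const d L eps) / 2.
have A0 : 0 < A.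
  by apply: divr_gt0; apply: mulr_gt0 => //; exact: exprn_gt0.
have B0 : 0 <= B.
  apply: divr_ge0 => //; apply: addr_ge0 => //.
  apply: mulr_ge0; first exact: expR_ge0.
  apply: mulr_ge0; first exact: sqr_ge0.
  by apply: divr_ge0; [exact: expR_ge0|rewrite subr_ge0 expR_le1; lra].
(* normg is arbitrary when C0 is chosen, hence the absolute value *)
pose C0 := A + A * (`|normg| * B) + 1.
have AB0 : 0 <= A * (`|normg| * B) by apply: mulr_ge0; [exact: ltW|exact: mulr_ge0].
have C1 : 1 <= C0 by rewrite /C0; lra.
exists (2 * C0); split; first lra.
move=> lam phi deb gamma omega _ wO _ spec T M f g T0 Gf GM ig normgE ag.
have w0 := observation_set_nonempty R d Omega omega lam phi C_S C_S_gt0 spec.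
have M_ge0 : 0 <= M by apply: le_trans GM; exact: sqrtr_ge0.
have rho0 : 0 <= rho by lra.
have fM := gevrey_L2norm_le R d Omega lam phi rho M f deb rho0 M_ge0 Gf GM.
set u := duhamel Omega lam phi g f T.
have [M0|Mn0] := eqVneq M 0.
  apply: (@le_trans _ _ 0%E); first by rewrite lee_fin -M0.
  by rewrite mule_ge0 ?poweR_ge0// lee_fin mulr_ge0 ?powR_ge0//; lra.
have M0 : 0 < M by rewrite lt_neqAle eq_sym Mn0.
have a0 : q / (p + q) != 0 by rewrite gt_eqF// divr_gt0.
have sup0 : (0 <= sup_abs omega u)%E.
  have [x wx] := w0.
  apply: (@le_trans _ _ (`|u x|%:E)%E); first by rewrite lee_fin.
  by apply: ereal_sup_ubound; exists x.
have CM0 : 0 < 2 * C0 * M `^ (1 - q / (p + q)) by rewrite mulr_gt0 ?powR_gt0//; lra.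
case supE : (sup_abs omega u) sup0 => [U| |//] sup0; last first.
  by rewrite poweRyr// gt0_muley ?leey// lte_fin.
rewrite lee_fin in sup0.
rewrite poweR_EFin -EFinM lee_fin.
have uU x : omega x -> `|u x| <= U.
  by move=> wx; rewrite -lee_fin -supE; apply: ereal_sup_ubound; exists x.
apply: interpolation_optimization => //; first exact: L2norm_ge0.
move=> r r0.
have er : eps <= rho by rewrite /eps; lra.
have r20 : 0 < r ^+ 2 by rewrite exprn_gt0.
have := cutoff_estimate Omega omega lam phi C_S rho eps c_g L T M f g oO L0 OL deb wO
  C_S_gt0 e0 er M0 cg0 spec Gf GM ig ag (r ^+ 2) U r20 w0 uU.
rewrite sqrtr_sqr gtr0_norm// -normgE.
have n0 : 0 <= normg by rewrite normgE; apply: Rintegral_ge0 => s _.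
rewrite -/B -[M * _ / 2]mulrA -/B => /le_trans; apply.
set Er := expR (C_S * r).
set W := U + _.
have W0 : 0 <= W.
  apply: addr_ge0 => //; apply: mulr_ge0 => //; apply: mulr_ge0; last exact: expR_ge0.
  by apply: mulr_ge0 => //; exact: ltW.
have step1 : r ^+ 2 / c_g * (C_S * Er * W) <= A * (expR (p * r) * W).
  have -> : A * (expR (p * r) * W) =
      (2 / eps ^+ 2 * expR (eps * r)) * (C_S / c_g * Er * W).
    rewrite /p mulrDl expRD -/Er /A; field.
    by rewrite !gt_eqF.
  have -> : r ^+ 2 / c_g * (C_S * Er * W) = r ^+ 2 * (C_S / c_g * Er * W) by ring.
  apply: ler_wpM2r; last by apply: sqr_le_expR => //; exact: ltW.
  by rewrite !mulr_ge0 ?expR_ge0 ?invr_ge0 ?(ltW cg0) ?(ltW C_S_gt0).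
have step2 : expR (p * r) * W = expR (p * r) * U + M * (`|normg| * B) * expR (- q * r).
  (* p - (rho - eps) = - q: the tail decays faster than the cost grows *)
  have -> : expR (- q * r) = expR (p * r) * expR (- (rho - eps) * r).
    by rewrite -expRD; congr expR; rewrite /p /q /eps; field.
  by rewrite /W ger0_norm//; ring.
have step3 : M * expR (- rho * r) <= M * expR (- q * r).
  by rewrite ler_pM2l// ler_expR; rewrite ler_wpM2r ?(ltW r0)// /q; lra.
have x1 : 0 <= (A * (`|normg| * B) + 1) * (expR (p * r) * U).
  by apply: mulr_ge0; [lra|exact: mulr_ge0 (expR_ge0 _) sup0].
have x2 : 0 <= A * (M * expR (- q * r)).
  by apply: mulr_ge0 (ltW A0) _; exact: mulr_ge0 M_ge0 (expR_ge0 _).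
rewrite step2 in step1.
have -> : C0 * (expR (p * r) * U + M * expR (- q * r)) =
  A * (expR (p * r) * U + M * (`|normg| * B) * expR (- q * r)) + M * expR (- q * r)
  + (A * (`|normg| * B) + 1) * (expR (p * r) * U) + A * (M * expR (- q * r)).
  by rewrite /C0; ring.
lra.
Qed.
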